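(* Let $\alpha = \pi/4$ and $\beta = \frac12\cos^{-1}\!\left(\frac{67-24\sqrt2}{71}\right)$, and let $B:\mathbb{R}\to S^2\subset\mathbb{R}^3$ be the spherical $(1,-3)$-epicycle with radii $(\alpha,\beta)$, i.e. $B(t)$ is the first column of the matrix $Q_{t}\,C\,S_\alpha\,R_{-3t}\,S_\beta$, where the matrices $Q_t, C, S_t, R_t$ are those given in the context. Define $$\gamma(t)=\int_0^t B(u)\times B'(u)\,du .$$ Then $\gamma$ is a regular closed curve (of period $2\pi$ in $t$) in $\mathbb{R}^3$ which is unknotted, has constant torsion $\tau = 1$, and has everywhere positive curvature.
   Context: Set $U=\frac{1}{\sqrt3}(1,1,1)^{\mathrm t}$, $V=\frac{1}{\sqrt6}(-1,-1,2)^{\mathrm t}$, $W=U\times V=\frac1{\sqrt2}(1,-1,0)^{\mathrm t}$, and let $C=(U,V,W)$ be the matrix with these columns. Define $$R_t=\begin{pmatrix}1&0&0\\0&\cos t&-\sin t\\0&\sin t&\cos t\end{pmatrix},\qquad S_t=\begin{pmatrix}\cos t&-\sin t&0\\ \sin t&\cos t&0\\0&0&1\end{pmatrix},$$ $$Q_t=I+\sin t\,\bar U+(1-\cos t)\,\bar U^2,\qquad \bar U=\frac{1}{\sqrt3}\begin{pmatrix}0&-1&1\\1&0&-1\\-1&1&0\end{pmatrix},$$ so that $Q_t$ is rotation by angle $t$ about $U$. For integers $m,n$, the spherical $(m,n)$-epicycle with radii $(\alpha,\beta)$ is the curve $B(t)$ given by the first column of $Q_{mt}\,C\,S_\alpha\,R_{nt}\,S_\beta$.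 Curvature and torsion of a regular space curve are those of the Frenet equations with respect to arclength $s$: $T'=\kappa N$, $N'=-\kappa T+\tau B$, $B'=-\tau N$, where $(T,N,B)$ is a positively oriented orthonormal frame and $T$ is the unit tangent. ''Everywhere positive curvature'' means that $\kappa=\|dT/ds\|$ is strictly positive at every point. ''Unknotted'' means that the curve is a simple closed curve which is isotopic in $\mathbb{R}^3$ to a round circle. *)

(* Defs.v *)
(* Stdlib reals with Coquelicot.  Space vectors are triples, so that they inherit
   Coquelicot's product topology and normed-module structure; 3x3 matrices are
   Coquelicot matrices, i.e. tuples of rows. *)
From Stdlib Require Import Reals ZArith.
From Coquelicot Require Import Coquelicot.
Open Scope R_scope.

Notation vec3 := (R * R * R)%type.
Notation mat3 := (@matrix R 3 3).

Definition vx (v : vec3) : R := fst (fst v).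
Definition vy (v : vec3) : R := snd (fst v).
Definition vz (v : vec3) : R := snd v.

Definition dot (u v : vec3) : R := vx u * vx v + vy u * vy v + vz u * vz v.

Definition vnorm (v : vec3) : R := sqrt (dot v v).

Definition cross (u v : vec3) : vec3 :=
  (vy u * vz v - vz u * vy v,
   vz u * vx v - vx u * vz v,
   vx u * vy v - vy u * vx v).

Definition vDerive (f : R -> vec3) (t : R) : vec3 :=
  (Derive (fun u => vx (f u)) t,
   Derive (fun u => vy (f u)) t,
   Derive (fun u => vz (f u)) t).

Definition vRInt (f : R -> vec3) (a b : R) : vec3 :=
  (RInt (fun u => vx (f u)) a b,
   RInt (fun u => vy (f u)) a b,
   RInt (fun u => vz (f u)) a b).

Definition mscal (a : R) (M : mat3) : mat3 :=
  mk_matrix 3 3 (fun i j => a * coeff_mat 0 M i j).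

Definition of_columns (u v w : vec3) : mat3 :=
  [[vx u, vx v, vx w],
   [vy u, vy v, vy w],
   [vz u, vz v, vz w]].

Definition first_column (M : mat3) : vec3 :=
  (coeff_mat 0 M 0 0, coeff_mat 0 M 1 0, coeff_mat 0 M 2 0).

Definition Uvec : vec3 := scal (1 / sqrt 3) ((1, 1, 1) : vec3).
Definition Vvec : vec3 := scal (1 / sqrt 6) ((-1, -1, 2) : vec3).
Definition Wvec : vec3 := cross Uvec Vvec.

Definition Cmat : mat3 := of_columns Uvec Vvec Wvec.

Definition Rmat (t : R) : mat3 :=
  [[1, 0, 0],
   [0, cos t, - sin t],
   [0, sin t, cos t]].

Definition Smat (t : R) : mat3 :=
  [[cos t, - sin t, 0],
   [sin t, cos t, 0],
   [0, 0, 1]].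

Definition Ubar : mat3 :=
  mscal (1 / sqrt 3)
    [[0, -1, 1],
     [1, 0, -1],
     [-1, 1, 0]].

Definition Qmat (t : R) : mat3 :=
  Mplus (Mplus Mone (mscal (sin t) Ubar))
        (mscal (1 - cos t) (Mmult Ubar Ubar)).

Definition epicycle (m n : Z) (alpha beta : R) (t : R) : vec3 :=
  first_column
    (Mmult (Mmult (Mmult (Mmult (Qmat (IZR m * t)) Cmat) (Smat alpha))
                  (Rmat (IZR n * t)))
           (Smat beta)).

Definition smooth_curve (g : R -> vec3) : Prop :=
  forall (n : nat) (t : R),
    ex_derive_n (fun u => vx (g u)) n t /\
    ex_derive_n (fun u => vy (g u)) n t /\
    ex_derive_n (fun u => vz (g u)) n t.

Definition regular_curve (g : R -> vec3) : Prop :=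
  smooth_curve g /\ forall t, vDerive g t <> (0, 0, 0).

Definition closed_curve (P : R) (g : R -> vec3) : Prop :=
  forall t, g (t + P) = g t.

Definition simple_closed_curve (P : R) (g : R -> vec3) : Prop :=
  closed_curve P g /\
  forall t u, 0 <= t < P -> 0 <= u < P -> g t = g u -> t = u.

Definition curve_image (g : R -> vec3) : vec3 -> Prop :=
  fun p => exists t, p = g t.

Definition round_circle (K : vec3 -> Prop) : Prop :=
  exists (c e1 e2 : vec3) (r : R),
    0 < r /\ dot e1 e1 = 1 /\ dot e2 e2 = 1 /\ dot e1 e2 = 0 /\
    forall p, K p <->
      exists theta,
        p = plus c (plus (scal (r * cos theta) e1) (scal (r * sin theta) e2)).

Definition homeomorphism (h : vec3 -> vec3) : Prop :=
  (forall p, continuous h p) /\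
  exists k : vec3 -> vec3,
    (forall p, continuous k p) /\
    (forall p, k (h p) = p) /\ (forall p, h (k p) = p).

(* Isotopy of knots is ambient isotopy: a continuous deformation through
   embeddings alone would pull every tame knot tight to the unknot. *)
Definition isotopic (K L : vec3 -> Prop) : Prop :=
  exists H : R -> vec3 -> vec3,
    continuous_on (fun q : R * vec3 => 0 <= fst q <= 1)
                  (fun q : R * vec3 => H (fst q) (snd q)) /\
    (forall s, 0 <= s <= 1 -> homeomorphism (H s)) /\
    (forall p, H 0 p = p) /\
    (forall q, L q <-> exists p, K p /\ q = H 1 p).

Definition unknotted (P : R) (g : R -> vec3) : Prop :=
  simple_closed_curve P g /\
  exists K, round_circle K /\ isotopic (curve_image g) K.

Definition arclength (g : R -> vec3) (t : R) : R :=
  RInt (fun u => vnorm (vDerive g u)) 0 t.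

Definition oriented_orthonormal (u v w : vec3) : Prop :=
  dot u u = 1 /\ dot v v = 1 /\ dot w w = 1 /\
  dot u v = 0 /\ dot u w = 0 /\ dot v w = 0 /\
  0 < dot (cross u v) w.

Definition frenet (c T N B : R -> vec3) (kappa tau : R -> R) : Prop :=
  forall s,
    oriented_orthonormal (T s) (N s) (B s) /\
    is_derive c s (T s) /\
    is_derive T s (scal (kappa s) (N s)) /\
    is_derive N s (plus (scal (- kappa s) (T s)) (scal (tau s) (B s))) /\
    is_derive B s (scal (- tau s) (N s)) /\
    kappa s = vnorm (vDerive T s).

(* kappa and tau are functions of the arclength s, and c is the curve
   reparametrized by s.  Where kappa > 0 the frame is determined by c. *)
Definition curvature_torsion (g : R -> vec3) (kappa tau : R -> R) : Prop :=
  exists c T N B : R -> vec3,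
    (forall t, g t = c (arclength g t)) /\ frenet c T N B kappa tau.

(* Main.v *)
Require Import Defs.
From Stdlib Require Import Reals ZArith Lra Psatz Nsatz Ranalysis5.
From Stdlib Require Import FunctionalExtensionality.
From Coquelicot Require Import Coquelicot.
Open Scope R_scope.

(** In the orthonormal frame (U, V, W) the epicycle is, up to rotation by the angle t
    about U, a trigonometric curve in 3t.  The value of beta is the one for which
    cot beta squared is 3 sqrt 2 - 3/2; this makes the U-component of B x B' have
    mean zero, while its two other components have mean zero because of the
    threefold symmetry.  Hence the integral gamma is, up to a similarity, an explicit
    trigonometric curve [model] (lemma [is_vderive_model]), which gives smoothness and
    periodicity.

    Curvature and torsion.  For a curve b on the unit sphere with speed r, the
    frame T = (b x b')/r, N = b'/r, -b is oriented and orthonormal, and it is the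
    Frenet frame of an antiderivative of b x b'.  The third vector
    has derivative -b' = -r N, so the torsion is 1; the curvature is
    -det(b, b', b'')/r^3 ([spherical_torsion_one]).  Here the determinant is a cubic
    polynomial in cos 3t, negative on [-1, 1] ([profile_det]).

    Unknottedness.  Seen along U, the curve is a triangle with a small kink at each
    corner, so that its polar angle is not monotone.  Each kink is crossed while the
    coordinate along U changes quickly, and rotating every plane
    orthogonal to U by an angle proportional to its height ([twist]) undoes all three
    kinks at once: afterwards the polar angle is strictly increasing
    ([angle'_bound]) and grows by one turn per period.  Such a curve is a graph over
    its angle, and can be pushed into a plane and then moved radially to the unit
    circle ([winding_isotopy]).  The extension of these two moves to space uses
    functions of the polar angle multiplied by the distance to the axis
    ([conical]), which are continuous on the axis as well.  All three moves
    are performed simultaneously, which composes the isotopies without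
    concatenating them in time. *)

(** * Continuity of real-valued maps and of triples *)

Lemma continuous_pair {U V W : UniformSpace} (f : U -> V) (g : U -> W) (x : U) :
  continuous f x -> continuous g x -> continuous (fun u => (f u, g u)) x.
Proof.
  intros Hf Hg.
  apply (continuous_comp_2 f g (fun a b => (a, b)) x Hf Hg).
  apply continuous_ext with (f := fun p : V * W => p).
  - now intros [a b].
  - apply continuous_id.
Qed.

Lemma continuous_Rplus {U : UniformSpace} (f g : U -> R) x :
  continuous f x -> continuous g x -> continuous (fun u => f u + g u) x.
Proof. exact (continuous_plus f g x). Qed.

Lemma continuous_Ropp {U : UniformSpace} (f : U -> R) x :
  continuous f x -> continuous (fun u => - f u) x.
Proof. exact (continuous_opp f x). Qed.

Lemma continuous_Rminus {U : UniformSpace} (f g : U -> R) x :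
  continuous f x -> continuous g x -> continuous (fun u => f u - g u) x.
Proof. exact (continuous_minus f g x). Qed.

Lemma continuous_Rmult {U : UniformSpace} (f g : U -> R) x :
  continuous f x -> continuous g x -> continuous (fun u => f u * g u) x.
Proof. exact (continuous_mult f g x). Qed.

Lemma continuous_comp_R {U : UniformSpace} (f : U -> R) (h : R -> R) x :
  continuous f x -> continuous h (f x) -> continuous (fun u => h (f u)) x.
Proof. exact (continuous_comp f h x). Qed.

Lemma continuous_Rdiv {U : UniformSpace} (f g : U -> R) x :
  continuous f x -> continuous g x -> g x <> 0 ->
  continuous (fun u => f u / g u) x.
Proof.
  intros Hf Hg Hx. apply continuous_Rmult; [exact Hf|].
  now apply (continuous_comp_R g Rinv x Hg), continuous_Rinv.
Qed.

Lemma continuous_coords {U : UniformSpace} (h : U -> vec3) (u : U) :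
  continuous h u ->
  continuous (fun w => vx (h w)) u /\ continuous (fun w => vy (h w)) u /\
  continuous (fun w => vz (h w)) u.
Proof.
  intros H.
  assert (Hf : forall A B (p : prod_UniformSpace A B), continuous (fst : A * B -> A) p)
    by (intros A B [a b]; apply continuous_fst).
  assert (Hs : forall A B (p : prod_UniformSpace A B), continuous (snd : A * B -> B) p)
    by (intros A B [a b]; apply continuous_snd).
  unfold vx, vy, vz. repeat split.
  - apply (continuous_comp (fun w => fst (h w)) fst); [|apply Hf].
    apply (continuous_comp h fst); [exact H|apply Hf].
  - apply (continuous_comp (fun w => fst (h w)) snd); [|apply Hs].
    apply (continuous_comp h fst); [exact H|apply Hf].
  - apply (continuous_comp h snd); [exact H|apply Hs].
Qed.

Lemma continuous_triple {U : UniformSpace} (f g h : U -> R) (x : U) :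
  continuous f x -> continuous g x -> continuous h x ->
  continuous (fun u => ((f u, g u, h u) : vec3)) x.
Proof.
  intros Hf Hg Hh. apply continuous_pair; [now apply continuous_pair|exact Hh].
Qed.

Ltac continuous_tac :=
  try assumption;
  lazymatch goal with
  | |- continuous (fun _ => (_, _, _)) _ => apply continuous_triple; continuous_tac
  | |- continuous (fun u => @?f u + @?g u) ?x =>
      apply (continuous_Rplus f g x); continuous_tac
  | |- continuous (fun u => @?f u - @?g u) ?x =>
      apply (continuous_Rminus f g x); continuous_tac
  | |- continuous (fun u => @?f u * @?g u) ?x =>
      apply (continuous_Rmult f g x); continuous_tac
  | |- continuous (fun u => - @?f u) ?x =>
      apply (continuous_Ropp f x); continuous_tac
  | |- continuous (fun u => cos (@?f u)) ?x =>
      apply (continuous_comp_R f cos x); [continuous_tac|apply continuous_cos]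
  | |- continuous (fun u => sin (@?f u)) ?x =>
      apply (continuous_comp_R f sin x); [continuous_tac|apply continuous_sin]
  | |- continuous (fun _ => ?c) _ => apply continuous_const
  | |- continuous (fun u => u) _ => apply continuous_id
  | _ => idtac
  end.

(** * Ambient isotopies *)

(** Joint continuity is asked for at all real times, so that slices and composites
    involve no subspace topology. *)
Definition ambient_isotopy (H : R -> vec3 -> vec3) : Prop :=
  (forall q : R * vec3,
     continuous (fun q : R * vec3 => H (fst q) (snd q)) q) /\
  (forall s, 0 <= s <= 1 -> homeomorphism (H s)) /\
  (forall p, H 0 p = p).

Lemma continuous_slice (H : R -> vec3 -> vec3) (s : R) :
  (forall q : R * vec3, continuous (fun q : R * vec3 => H (fst q) (snd q)) q) ->
  forall p, continuous (H s) p.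
Proof.
  intros C p.
  apply (continuous_comp (fun p : vec3 => (s, p))
           (fun q : R * vec3 => H (fst q) (snd q)) p); [|apply C].
  apply continuous_pair; [apply continuous_const|apply continuous_id].
Qed.

Lemma homeomorphism_comp (h1 h2 : vec3 -> vec3) :
  homeomorphism h1 -> homeomorphism h2 ->
  homeomorphism (fun p => h2 (h1 p)).
Proof.
  intros [C1 (k1 & D1 & L1 & R1)] [C2 (k2 & D2 & L2 & R2)]. split.
  - intros p. apply (continuous_comp h1 h2 p); auto.
  - exists (fun p => k1 (k2 p)). repeat split.
    + intros p. apply (continuous_comp k2 k1 p); auto.
    + intros p. now rewrite L2.
    + intros p. now rewrite R1.
Qed.

(** Running both isotopies at the same time replaces the usual concatenation, and
    keeps joint continuity a matter of composition. *)
Lemma ambient_isotopy_comp (H1 H2 : R -> vec3 -> vec3) :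
  ambient_isotopy H1 -> ambient_isotopy H2 ->
  ambient_isotopy (fun s p => H2 s (H1 s p)).
Proof.
  intros (C1 & M1 & I1) (C2 & M2 & I2). repeat split.
  - intros q.
    apply (continuous_comp_2 (fun q : R * vec3 => fst q)
             (fun q : R * vec3 => H1 (fst q) (snd q)) H2 q).
    + destruct q; apply continuous_fst.
    + apply C1.
    + apply C2.
  - now apply (homeomorphism_comp (H1 s) (H2 s)); [apply M1|apply M2].
  - now apply (homeomorphism_comp (H1 s) (H2 s)); [apply M1|apply M2].
  - intros p. now rewrite I1, I2.
Qed.

(** Transports an isotopy from model coordinates to the space in which the curve
    lives. *)
Lemma ambient_isotopy_conj (H : R -> vec3 -> vec3) (h k : vec3 -> vec3) :
  ambient_isotopy H ->
  (forall p, continuous h p) -> (forall p, continuous k p) ->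
  (forall p, k (h p) = p) -> (forall p, h (k p) = p) ->
  ambient_isotopy (fun s p => h (H s (k p))).
Proof.
  intros (C & M & I) Ch Ck L L'.
  assert (Hh : homeomorphism h) by (split; [|exists k]; auto).
  assert (Hk : homeomorphism k) by (split; [|exists h]; auto).
  split; [|split].
  - intros q.
    apply (continuous_comp (fun q : R * vec3 => H (fst q) (k (snd q))) h q);
      [|apply Ch].
    apply (continuous_comp_2 (fun q : R * vec3 => fst q)
             (fun q : R * vec3 => k (snd q)) H q).
    + destruct q; apply continuous_fst.
    + apply (continuous_comp (fun q : R * vec3 => snd q) k q);
        [destruct q; apply continuous_snd|apply Ck].
    + apply C.
  - intros s Hs.
    apply (homeomorphism_comp (fun p => H s (k p)) h); [|exact Hh].
    apply (homeomorphism_comp k (H s)); auto.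
  - intros p. now rewrite I.
Qed.

Lemma isotopic_image (H : R -> vec3 -> vec3) (K : vec3 -> Prop) :
  ambient_isotopy H -> isotopic K (fun q => exists p, K p /\ q = H 1 p).
Proof.
  intros (C & M & I). exists H. split; [|split; [|split]]; auto.
  - intros q _. eapply filterlim_filter_le_1; [|apply C].
    apply filter_le_within.
  - intros q. reflexivity.
Qed.

(** * Inverses of functions with derivative bounded below *)

Lemma increasing_of_derive_bound (f f' : R -> R) (m : R) :
  (forall t, is_derive f t (f' t)) -> (forall t, m <= f' t) ->
  forall a b, a <= b -> m * (b - a) <= f b - f a.
Proof.
  intros D Hm a b [Hab| ->]; [|lra].
  destruct (MVT_gen f a b f') as (c & _ & ->).
  - intros; apply D.
  - intros x _. apply continuity_pt_filterlim.
    apply (ex_derive_continuous f). now exists (f' x).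
  - apply Rmult_le_compat_r; [lra|apply Hm].
Qed.

(** The lower bound m on the derivative makes f onto, and makes the inverse
    Lipschitz with constant 1/m, hence continuous, before its derivative is
    computed. *)
Lemma inverse_of_derive_bound (f f' : R -> R) (m : R) :
  0 < m -> (forall t, is_derive f t (f' t)) -> (forall t, m <= f' t) ->
  exists g : R -> R,
    (forall t, g (f t) = t) /\ (forall s, f (g s) = s) /\
    (forall s, is_derive g s (/ f' (g s))).
Proof.
  intros m0 D Hm.
  pose proof (increasing_of_derive_bound f f' m D Hm) as Hinc.
  assert (Cf : continuity f).
  { intros x. apply continuity_pt_filterlim, (ex_derive_continuous f).
    now exists (f' x). }
  assert (Hsur : forall s, {t | f t = s}).
  { intros s.
    (* By the mean value inequality f moves by more than |s - f 0| over a length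
       M on either side of 0, so the value s is attained there. *)
    set (M := (Rabs (s - f 0)) / m + 1).
    assert (HM : Rabs (s - f 0) < m * M).
    { unfold M. rewrite Rmult_plus_distr_l.
      replace (m * (Rabs (s - f 0) / m)) with (Rabs (s - f 0)) by (field; lra).
      lra. }
    assert (M0 : 0 < M).
    { unfold M. pose proof (Rabs_pos (s - f 0)).
      assert (0 <= Rabs (s - f 0) / m) by (apply Rdiv_le_0_compat; lra). lra. }
    apply Rabs_def2 in HM.
    pose proof (Hinc 0 M ltac:(lra)). pose proof (Hinc (- M) 0 ltac:(lra)).
    destruct (IVT_interv (fun t => f t - s) (- M) M) as (t & _ & Ht).
    - intros a _. apply continuity_pt_minus; [apply Cf|].
      apply continuity_pt_const. now intros ? ?.
    - lra.
    - lra.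
    - lra.
    - exists t. lra. }
  set (g := fun s => proj1_sig (Hsur s)).
  assert (Hfg : forall s, f (g s) = s) by (intros s; apply (proj2_sig (Hsur s))).
  assert (Hgf : forall t, g (f t) = t).
  { intros t. pose proof (Hfg (f t)) as E.
    destruct (Rtotal_order (g (f t)) t) as [H|[H|H]]; [|exact H|].
    - pose proof (Hinc _ _ (Rlt_le _ _ H)). nra.
    - pose proof (Hinc _ _ (Rlt_le _ _ H)). nra. }
  assert (Hg : forall a b, a <= b -> 0 <= g b - g a <= (b - a) / m).
  { intros a b Hab. destruct (Rle_lt_dec (g a) (g b)) as [H|H].
    - pose proof (Hinc _ _ H) as E. rewrite !Hfg in E. split; [lra|].
      apply Rmult_le_reg_l with m; [lra|].
      replace (m * ((b - a) / m)) with (b - a) by (field; lra). lra.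
    - pose proof (Hinc _ _ (Rlt_le _ _ H)) as E. rewrite !Hfg in E. nra. }
  exists g. split; [exact Hgf|]. split; [exact Hfg|].
  intros s. apply is_derive_Reals.
  assert (Prf : forall a, g (s - 1) <= a <= g (s + 1) -> derivable_pt f a).
  { intros a _. exists (f' a). apply is_derive_Reals, D. }
  assert (Hin : g (s - 1) <= g s <= g (s + 1)).
  { pose proof (Hg (s - 1) s ltac:(lra)). pose proof (Hg s (s + 1) ltac:(lra)). lra. }
  assert (E : derive_pt f (g s) (Prf (g s) Hin) = f' (g s)).
  { apply derive_pt_eq_0, is_derive_Reals, D. }
  replace (/ f' (g s)) with (1 / derive_pt f (g s) (Prf (g s) Hin))
    by (rewrite E; unfold Rdiv; ring).
  apply (derivable_pt_lim_recip_interv f g (s - 1) (s + 1) s Prf).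
  - intros eps Heps. exists (m * eps). split; [nra|].
    intros x [_ Hx]. simpl in *. unfold Rdist in *.
    assert (Hb : Rabs (g x - g s) <= Rabs (x - s) / m).
    { destruct (Rle_lt_dec s x) as [H|H].
      - pose proof (Hg s x H). rewrite !Rabs_pos_eq; lra.
      - pose proof (Hg x s ltac:(lra)). rewrite (Rabs_minus_sym (g x)), (Rabs_minus_sym x).
        rewrite !Rabs_pos_eq; lra. }
    apply Rle_lt_trans with (1 := Hb).
    apply Rmult_lt_reg_l with m; [lra|].
    replace (m * (Rabs (x - s) / m)) with (Rabs (x - s)) by (field; lra). lra.
  - lra.
  - lra.
  - intros x _. apply Hfg.
  - rewrite E. pose proof (Hm (g s)). lra.
Qed.

(** * Polar coordinates *)

Lemma polar_atan (x y : R) :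
  0 < x ->
  sqrt (x * x + y * y) * cos (atan (y / x)) = x /\
  sqrt (x * x + y * y) * sin (atan (y / x)) = y.
Proof.
  intros Hx. rewrite cos_atan, sin_atan.
  assert (E : sqrt (x * x + y * y) = x * sqrt (1 + (y / x)²)).
  { transitivity (sqrt (x * x) * sqrt (1 + (y / x)²)).
    - rewrite <- sqrt_mult_alt by nra. f_equal. unfold Rsqr. field. lra.
    - now rewrite sqrt_square by lra. }
  assert (0 < sqrt (1 + (y / x)²)).
  { apply sqrt_lt_R0. pose proof (Rle_0_sqr (y / x)). lra. }
  rewrite E. split; field; lra.
Qed.

Lemma cos_sqr_plus_sin_sqr (a : R) : cos a * cos a + sin a * sin a = 1.
Proof. pose proof (sin2_cos2 a) as H. unfold Rsqr in H. lra. Qed.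

(** Two angles with the same direction differ by 2 PI k, because the half difference
    is a zero of the sine. *)
Lemma same_direction (a b : R) :
  cos a = cos b -> sin a = sin b -> exists k : Z, a = b + 2 * PI * IZR k.
Proof.
  intros Hc Hs.
  assert (E : sin ((a - b) / 2) = 0).
  { pose proof (cos_2a_sin ((a - b) / 2)) as H.
    replace (2 * ((a - b) / 2)) with (a - b) in H by field.
    rewrite cos_minus, Hc, Hs in H. pose proof (cos_sqr_plus_sin_sqr b). nra. }
  destruct (sin_eq_0_0 _ E) as (k & Hk). exists k. lra.
Qed.

Definition periodic (P : R) (f : R -> R) : Prop := forall t, f (t + P) = f t.

Lemma periodic_cos : periodic (2 * PI) cos.
Proof. intros t. rewrite cos_plus, cos_2PI, sin_2PI. ring. Qed.

Lemma periodic_sin : periodic (2 * PI) sin.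
Proof. intros t. rewrite sin_plus, cos_2PI, sin_2PI. ring. Qed.

Lemma periodic_Z (P : R) (f : R -> R) (k : Z) (t : R) :
  periodic P f -> f (t + P * IZR k) = f t.
Proof.
  intros Hf.
  assert (Hn : forall (n : nat) t, f (t + P * INR n) = f t).
  { induction n as [|n IH]; intros x.
    - simpl. now rewrite Rmult_0_r, Rplus_0_r.
    - rewrite S_INR.
      replace (x + P * (INR n + 1)) with (x + P * INR n + P) by ring.
      now rewrite Hf. }
  destruct (Z_le_gt_dec 0 k) as [H|H].
  - rewrite <- (Z2Nat.id k H), <- INR_IZR_INZ. apply Hn.
  - rewrite <- (Hn (Z.to_nat (- k)) (t + P * IZR k)).
    rewrite INR_IZR_INZ, Z2Nat.id, opp_IZR by lia.
    f_equal. ring.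
Qed.

Lemma periodic_same_direction (f : R -> R) (a b : R) :
  periodic (2 * PI) f -> cos a = cos b -> sin a = sin b -> f a = f b.
Proof.
  intros Hf Hc Hs. destruct (same_direction a b Hc Hs) as (k & ->).
  now apply periodic_Z.
Qed.

Definition polar_radius (y z : R) : R := sqrt (y * y + z * z).

(** At the origin the angle is acos 0, a value that is always multiplied by the
    radius 0. *)
Definition polar_angle (y z : R) : R :=
  if Rle_dec 0 z then acos (y / polar_radius y z)
  else - acos (y / polar_radius y z).

Lemma polar_radius_pos (y z : R) : y <> 0 \/ z <> 0 -> 0 < polar_radius y z.
Proof. intros H. apply sqrt_lt_R0. destruct H; nra. Qed.

Lemma polar_radius_sqr (y z : R) :
  polar_radius y z * polar_radius y z = y * y + z * z.
Proof. apply sqrt_sqrt. nra. Qed.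

Lemma polar_angle_spec (y z : R) :
  y = polar_radius y z * cos (polar_angle y z) /\
  z = polar_radius y z * sin (polar_angle y z).
Proof.
  assert (Hd : (y = 0 /\ z = 0) \/ 0 < polar_radius y z).
  { destruct (Req_dec y 0), (Req_dec z 0); auto using polar_radius_pos. }
  destruct Hd as [[-> ->]|Hr].
  - unfold polar_radius. rewrite Rmult_0_l, Rplus_0_l, sqrt_0. lra.
  - pose proof (polar_radius_sqr y z) as Hq.
    set (r := polar_radius y z) in *.
    assert (Hb : -1 <= y / r <= 1).
    { split; apply Rmult_le_reg_r with r; try lra;
        replace (y / r * r) with y by (field; lra); nra. }
    assert (Es : r * sqrt (1 - (y / r)²) = Rabs z).
    { transitivity (sqrt (r * r) * sqrt (1 - (y / r)²));
        [now rewrite sqrt_square by lra|].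
      rewrite <- sqrt_mult_alt by nra. rewrite <- sqrt_Rsqr_abs. f_equal.
      unfold Rsqr. replace (r * r * (1 - y / r * (y / r))) with (r * r - y * y)
        by (field; lra). lra. }
    unfold polar_angle. fold r. destruct (Rle_dec 0 z) as [Hz|Hz].
    + rewrite cos_acos, sin_acos, Es, Rabs_pos_eq by assumption.
      split; [field; lra|reflexivity].
    + rewrite cos_neg, sin_neg, cos_acos, sin_acos by assumption.
      rewrite Ropp_mult_distr_r_reverse, Es, Rabs_left by lra.
      split; [field; lra|ring].
Qed.

Lemma polar_angle_bound (y z : R) : - PI <= polar_angle y z <= PI.
Proof.
  unfold polar_angle. pose proof PI_RGT_0.
  destruct (Rle_dec 0 z);
    pose proof (acos_bound (y / polar_radius y z)); lra.
Qed.

(** The extension of a function of the direction to a positively homogeneous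
    function on the plane; the factor in front removes the singularity at the
    origin. *)
Definition conical (f : R -> R) (y z : R) : R :=
  polar_radius y z * f (polar_angle y z).

Lemma polar_radius_polar (r a : R) :
  0 <= r -> polar_radius (r * cos a) (r * sin a) = r.
Proof.
  intros Hr. unfold polar_radius.
  replace (r * cos a * (r * cos a) + r * sin a * (r * sin a))
    with (r * r * (cos a * cos a + sin a * sin a)) by ring.
  now rewrite cos_sqr_plus_sin_sqr, Rmult_1_r, sqrt_square.
Qed.

Lemma conical_polar (f : R -> R) (r a : R) :
  periodic (2 * PI) f -> 0 <= r -> conical f (r * cos a) (r * sin a) = r * f a.
Proof.
  intros Hf [Hr|<-].
  - destruct (polar_angle_spec (r * cos a) (r * sin a)) as [Hc Hs].
    unfold conical. rewrite polar_radius_polar in * by lra.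
    f_equal. apply periodic_same_direction; [exact Hf| |].
    + symmetry. now apply Rmult_eq_reg_l in Hc; [|lra].
    + symmetry. now apply Rmult_eq_reg_l in Hs; [|lra].
  - unfold conical, polar_radius.
    now rewrite !Rmult_0_l, Rplus_0_l, sqrt_0, !Rmult_0_l.
Qed.

Lemma continuous_polar_radius {U : UniformSpace} (f g : U -> R) (u : U) :
  continuous f u -> continuous g u ->
  continuous (fun w => polar_radius (f w) (g w)) u.
Proof.
  intros Hf Hg.
  apply (continuous_comp_R (fun w => f w * f w + g w * g w) sqrt).
  - continuous_tac.
  - apply continuous_sqrt.
Qed.

(** At the origin, f is bounded on the range of the polar angle and the radius tends
    to 0.  Elsewhere the polar angle may jump, but by periodicity it can be replaced
    near (y0, z0) by the continuous branch a0 + atan (d / c), where c and d are the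
    scalar product and the determinant of (y0, z0) with the moving point. *)
Lemma continuous_conical_at (f : R -> R) (y0 z0 : R) :
  periodic (2 * PI) f -> (forall t, continuous f t) ->
  continuous (fun p : R * R => conical f (fst p) (snd p)) (y0, z0).
Proof.
  intros Hp Hf.
  assert (Cy : continuous (fun p : R * R => fst p) (y0, z0)) by apply continuous_fst.
  assert (Cz : continuous (fun p : R * R => snd p) (y0, z0)) by apply continuous_snd.
  pose proof (continuous_polar_radius _ _ _ Cy Cz) as Cr.
  assert (Hd : (y0 = 0 /\ z0 = 0) \/ 0 < polar_radius y0 z0).
  { destruct (Req_dec y0 0), (Req_dec z0 0); auto using polar_radius_pos. }
  destruct Hd as [[-> ->]|Hr].
  - assert (E0 : polar_radius 0 0 = 0)
      by (unfold polar_radius; now rewrite Rmult_0_l, Rplus_0_l, sqrt_0).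
    destruct (continuity_ab_maj (fun t => Rabs (f t)) (- PI) PI) as (m & Hm & _).
    + pose proof PI_RGT_0. lra.
    + intros t _. apply continuity_pt_filterlim.
      apply (continuous_comp_R f Rabs t (Hf t)), continuous_Rabs.
    + set (M := Rabs (f m)) in *.
      assert (Cb : continuous
                (fun p : R * R => polar_radius (fst p) (snd p) * M) (0, 0))
        by (apply continuous_Rmult; [exact Cr|apply continuous_const]).
      apply filterlim_locally. intros eps.
      pose proof (proj1 (filterlim_locally _ _) Cb eps) as He.
      revert He. apply filter_imp. intros p Hb.
      unfold ball in *. simpl in *. unfold AbsRing_ball, abs, minus, plus, opp in *.
      simpl in *. unfold conical. rewrite !E0 in *. rewrite Rmult_0_l in *.
      rewrite Ropp_0, Rplus_0_r in *.
      eapply Rle_lt_trans; [|exact Hb].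
      rewrite !Rabs_mult. apply Rmult_le_compat_l; [apply Rabs_pos|].
      rewrite (Rabs_pos_eq M) by apply Rabs_pos.
      apply Hm, polar_angle_bound.
  - destruct (polar_angle_spec y0 z0) as [Ey Ez].
    set (r0 := polar_radius y0 z0) in *. set (a0 := polar_angle y0 z0) in *.
    set (c := fun p : R * R => y0 * fst p + z0 * snd p).
    set (d := fun p : R * R => y0 * snd p - z0 * fst p).
    assert (Cc : continuous c (y0, z0)) by (unfold c; continuous_tac).
    assert (Cd : continuous d (y0, z0)) by (unfold d; continuous_tac).
    assert (c0 : 0 < c (y0, z0)).
    { unfold c. simpl. rewrite <- polar_radius_sqr. fold r0. nra. }
    apply continuous_ext_loc with
      (g := fun p => polar_radius (fst p) (snd p) * f (a0 + atan (d p / c p))).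
    + assert (Hl : locally (y0, z0) (fun p => 0 < c p)).
      { apply (Cc (fun t => 0 < t)). now apply open_gt. }
      revert Hl. apply filter_imp. intros [y z] Hc. unfold conical. cbn [fst snd].
      destruct (polar_angle_spec y z) as [Fy Fz].
      assert (Hrp : 0 <= polar_radius y z) by apply sqrt_pos.
      set (r := polar_radius y z) in *. set (a := polar_angle y z) in *.
      assert (Hcc : c (y, z) = r * r0 * cos (a - a0)).
      { unfold c. simpl. rewrite cos_minus, Ey, Ez, Fy, Fz. ring. }
      assert (Hdd : d (y, z) = r * r0 * sin (a - a0)).
      { unfold d. simpl. rewrite sin_minus, Ey, Ez, Fy, Fz. ring. }
      destruct (polar_atan (c (y, z)) (d (y, z)) Hc) as [Hca Hsa].
      assert (Er : sqrt (c (y, z) * c (y, z) + d (y, z) * d (y, z)) = r * r0).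
      { rewrite Hcc, Hdd. apply polar_radius_polar. nra. }
      rewrite Er in Hca, Hsa.
      assert (Hrr : r * r0 <> 0).
      { intros E. rewrite Hcc, E in Hc. lra. }
      rewrite Hcc in Hca at 2. rewrite Hdd in Hsa at 2.
      apply Rmult_eq_reg_l in Hca; [|exact Hrr].
      apply Rmult_eq_reg_l in Hsa; [|exact Hrr].
      f_equal. apply periodic_same_direction; [exact Hp| |].
      * rewrite cos_plus, Hca, Hsa, <- cos_plus. f_equal. ring.
      * rewrite sin_plus, Hca, Hsa, <- sin_plus. f_equal. ring.
    + apply continuous_Rmult; [exact Cr|].
      apply (continuous_comp_R (fun p => a0 + atan (d p / c p)) f); [|apply Hf].
      apply continuous_Rplus; [apply continuous_const|].
      apply (continuous_comp_R (fun p => d p / c p) atan).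
      * apply continuous_Rdiv; [exact Cd|exact Cc|lra].
      * apply continuity_pt_filterlim, derivable_continuous_pt, derivable_pt_atan.
Qed.

Lemma continuous_conical {U : UniformSpace} (f : R -> R) (y z : U -> R) (u : U) :
  periodic (2 * PI) f -> (forall t, continuous f t) ->
  continuous y u -> continuous z u ->
  continuous (fun w => conical f (y w) (z w)) u.
Proof.
  intros Hp Hf Hy Hz.
  apply (continuous_comp_2 y z (conical f) u Hy Hz).
  now apply continuous_conical_at.
Qed.

(** * Three elementary isotopies *)

Definition twist (k s : R) (p : vec3) : vec3 :=
  (vx p, cos (s * k * vx p) * vy p - sin (s * k * vx p) * vz p,
         sin (s * k * vx p) * vy p + cos (s * k * vx p) * vz p).

Definition shear (f : R -> R) (s : R) (p : vec3) : vec3 :=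
  (vx p - s * conical f (vy p) (vz p), vy p, vz p).

Definition dilate (g : R -> R) (s : R) (p : vec3) : vec3 :=
  (vx p,
   (1 - s) * vy p + s * conical (fun a => g a * cos a) (vy p) (vz p),
   (1 - s) * vz p + s * conical (fun a => g a * sin a) (vy p) (vz p)).

Lemma continuous_param_coords (q : R * vec3) :
  continuous (fun q : R * vec3 => fst q) q /\
  continuous (fun q : R * vec3 => vx (snd q)) q /\
  continuous (fun q : R * vec3 => vy (snd q)) q /\
  continuous (fun q : R * vec3 => vz (snd q)) q.
Proof.
  split.
  - destruct q; apply continuous_fst.
  - apply (continuous_coords (fun q : R * vec3 => snd q)).
    destruct q; apply continuous_snd.
Qed.

Lemma continuous_id_coords (p : vec3) :
  continuous (fun p : vec3 => vx p) p /\ continuous (fun p : vec3 => vy p) p /\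
  continuous (fun p : vec3 => vz p) p.
Proof. apply (continuous_coords (fun p : vec3 => p)), continuous_id. Qed.

Lemma twist_isotopy (k : R) : ambient_isotopy (twist k).
Proof.
  assert (C : forall q : R * vec3,
             continuous (fun q : R * vec3 => twist k (fst q) (snd q)) q).
  { intros q. destruct (continuous_param_coords q) as (Cs & Cx & Cy & Cz).
    unfold twist. continuous_tac. }
  split; [exact C|split].
  - intros s _. split; [now apply continuous_slice|].
    exists (twist k (- s)). split; [now apply continuous_slice|].
    assert (K : forall s p, twist k (- s) (twist k s p) = p).
    { intros s' [[x y] z]. unfold twist, vx, vy, vz. simpl.
      replace (- s' * k * x) with (- (s' * k * x)) by ring.
      rewrite cos_neg, sin_neg. pose proof (cos_sqr_plus_sin_sqr (s' * k * x)) as E.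
      f_equal; [f_equal|].
      - transitivity (y * (cos (s' * k * x) * cos (s' * k * x) +
                             sin (s' * k * x) * sin (s' * k * x)));
          [ring|rewrite E; ring].
      - transitivity (z * (cos (s' * k * x) * cos (s' * k * x) +
                             sin (s' * k * x) * sin (s' * k * x)));
          [ring|rewrite E; ring]. }
    split; [apply K|].
    intros p. rewrite <- (Ropp_involutive s) at 1. apply K.
  - intros [[x y] z]. unfold twist, vx, vy, vz. simpl.
    rewrite !Rmult_0_l, cos_0, sin_0. f_equal; [f_equal|]; ring.
Qed.

Lemma shear_isotopy (f : R -> R) :
  periodic (2 * PI) f -> (forall t, continuous f t) -> ambient_isotopy (shear f).
Proof.
  intros Hp Hf.
  assert (C : forall q : R * vec3,
             continuous (fun q : R * vec3 => shear f (fst q) (snd q)) q).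
  { intros q. destruct (continuous_param_coords q) as (Cs & Cx & Cy & Cz).
    unfold shear. pose proof (continuous_conical f _ _ q Hp Hf Cy Cz).
    continuous_tac. }
  split; [exact C|split].
  - intros s _. split; [now apply continuous_slice|].
    exists (shear f (- s)). split; [now apply continuous_slice|].
    split; intros [[x y] z]; unfold shear, vx, vy, vz; simpl;
      f_equal; f_equal; ring.
  - intros [[x y] z]. unfold shear, vx, vy, vz. simpl.
    f_equal; f_equal; ring.
Qed.

Lemma dilate_polar (g : R -> R) (s x r a : R) :
  periodic (2 * PI) g -> 0 <= r ->
  dilate g s (x, r * cos a, r * sin a) =
  (x, r * (1 - s + s * g a) * cos a, r * (1 - s + s * g a) * sin a).
Proof.
  intros Hp Hr. unfold dilate, vx, vy, vz. simpl.
  rewrite !conical_polar; try assumption.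
  - f_equal; [f_equal|]; ring.
  - intros t. now rewrite Hp, periodic_sin.
  - intros t. now rewrite Hp, periodic_cos.
Qed.

(** For s in [0, 1] the map multiplies each half-line from the axis by the positive
    number m a = 1 - s + s g a of its direction a, so dividing by m a inverts it;
    the inverse is itself a dilation at time 1. *)
Lemma dilate_isotopy (g : R -> R) :
  periodic (2 * PI) g -> (forall t, continuous g t) -> (forall t, 0 < g t) ->
  ambient_isotopy (dilate g).
Proof.
  intros Hp Hg Pg.
  assert (C : forall g, periodic (2 * PI) g -> (forall t, continuous g t) ->
             forall q : R * vec3,
             continuous (fun q : R * vec3 => dilate g (fst q) (snd q)) q).
  { clear. intros g Hp Hg q.
    destruct (continuous_param_coords q) as (Cs & Cx & Cy & Cz).
    unfold dilate.
    assert (Hc : continuous (fun q : R * vec3 =>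
              conical (fun a => g a * cos a) (vy (snd q)) (vz (snd q))) q).
    { apply continuous_conical; try assumption.
      - intros t. now rewrite Hp, periodic_cos.
      - intros t. apply continuous_Rmult; [apply Hg|apply continuous_cos]. }
    assert (Hs : continuous (fun q : R * vec3 =>
              conical (fun a => g a * sin a) (vy (snd q)) (vz (snd q))) q).
    { apply continuous_conical; try assumption.
      - intros t. now rewrite Hp, periodic_sin.
      - intros t. apply continuous_Rmult; [apply Hg|apply continuous_sin]. }
    continuous_tac. }
  split; [now apply C|split].
  - intros s Hs. split; [now apply continuous_slice, C|].
    set (m := fun a => 1 - s + s * g a).
    assert (Pm : forall a, 0 < m a) by (intros a; unfold m; specialize (Pg a); nra).
    assert (Hpm : periodic (2 * PI) (fun a => / m a))
      by (intros t; unfold m; now rewrite Hp).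
    exists (dilate (fun a => / m a) 1). split.
    { apply continuous_slice, C; [exact Hpm|].
      intros t. apply (continuous_comp_R m Rinv).
      - unfold m. specialize (Hg t). continuous_tac.
      - apply continuous_Rinv. specialize (Pm t). lra. }
    split; intros [[x y] z]; destruct (polar_angle_spec y z) as [Ey Ez];
      assert (Hr : 0 <= polar_radius y z) by apply sqrt_pos;
      set (r := polar_radius y z) in *; set (a := polar_angle y z) in *;
      rewrite Ey, Ez; specialize (Pm a).
    + rewrite dilate_polar by assumption. fold (m a).
      rewrite dilate_polar; [|assumption|nra].
      f_equal; [f_equal|]; field; lra.
    + rewrite dilate_polar by assumption.
      rewrite dilate_polar; [|assumption|].
      * fold (m a). f_equal; [f_equal|]; field; lra.
      * apply Rmult_le_pos; [assumption|].
        pose proof (Rinv_0_lt_compat _ Pm). lra.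
  - intros [[x y] z]. unfold dilate, vx, vy, vz. simpl.
    f_equal; [f_equal|]; ring.
Qed.

(** * Vector calculus *)

(** Derivative of a space curve by coordinates; [is_derive_vec] turns it into the
    derivative in the normed module. *)
Definition is_vderive (f : R -> vec3) (t : R) (l : vec3) : Prop :=
  is_derive (fun u => vx (f u)) t (vx l) /\
  is_derive (fun u => vy (f u)) t (vy l) /\
  is_derive (fun u => vz (f u)) t (vz l).

Lemma vec_ext (p q : vec3) : vx p = vx q -> vy p = vy q -> vz p = vz q -> p = q.
Proof.
  destruct p as [[a b] c], q as [[d e] f]. unfold vx, vy, vz. simpl.
  now intros -> -> ->.
Qed.

Lemma vDerive_unique f t l : is_vderive f t l -> vDerive f t = l.
Proof.
  intros (Hx & Hy & Hz). apply vec_ext; unfold vDerive;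
    now apply is_derive_unique.
Qed.

Lemma is_derive_vec f t l : is_vderive f t l -> is_derive f t l.
Proof.
  intros (Hx & Hy & Hz).
  assert (E : forall p : vec3,
    plus (scal (vx p) ((1, 0, 0) : vec3))
      (plus (scal (vy p) ((0, 1, 0) : vec3)) (scal (vz p) ((0, 0, 1) : vec3))) = p).
  { intros [[a b] c]. apply vec_ext;
      unfold plus, scal, vx, vy, vz; simpl; unfold plus, scal, mult; simpl;
      unfold mult; simpl; ring. }
  rewrite <- (E l).
  apply is_derive_ext with (1 := fun u => E (f u)).
  apply (@is_derive_plus R_AbsRing); [|apply (@is_derive_plus R_AbsRing)];
    now apply @is_derive_scal_l.
Qed.

Lemma is_vderive_ext f g t l :
  (forall u, f u = g u) -> is_vderive f t l -> is_vderive g t l.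
Proof.
  intros E (Hx & Hy & Hz).
  split; [|split]; eapply is_derive_ext; try eassumption; intros u; simpl; now rewrite E.
Qed.

Lemma is_vderive_eq f t l m : is_vderive f t l -> l = m -> is_vderive f t m.
Proof. now intros H <-. Qed.

Lemma is_derive_eq (f : R -> R) (t l m : R) : is_derive f t l -> l = m -> is_derive f t m.
Proof. now intros H <-. Qed.

Lemma is_derive_Rmult (f g : R -> R) (t l m : R) :
  is_derive f t l -> is_derive g t m ->
  is_derive (fun u => f u * g u) t (l * g t + f t * m).
Proof. intros Hf Hg. apply (is_derive_mult f g t l m Hf Hg). intros; apply Rmult_comm. Qed.

Lemma is_derive_Rplus (f g : R -> R) (t l m : R) :
  is_derive f t l -> is_derive g t m -> is_derive (fun u => f u + g u) t (l + m).
Proof. apply (is_derive_plus f g). Qed.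

Lemma is_derive_Rminus (f g : R -> R) (t l m : R) :
  is_derive f t l -> is_derive g t m -> is_derive (fun u => f u - g u) t (l - m).
Proof. apply (is_derive_minus f g). Qed.

Lemma is_vderive_cross f g t l m :
  is_vderive f t l -> is_vderive g t m ->
  is_vderive (fun u => cross (f u) (g u)) t (plus (cross l (g t)) (cross (f t) m)).
Proof.
  intros (Fx & Fy & Fz) (Gx & Gy & Gz).
  assert (H : forall a b c d : R -> R, forall a' b' c' d' : R,
     is_derive a t a' -> is_derive b t b' -> is_derive c t c' -> is_derive d t d' ->
     is_derive (fun u => a u * b u - c u * d u) t
       ((a' * b t - c' * d t) + (a t * b' - c t * d'))).
  { intros. eapply is_derive_eq.
    - apply is_derive_Rminus; apply is_derive_Rmult; eassumption.
    - ring. }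
  split; [|split]; now apply H.
Qed.

Lemma is_derive_dot f g t l m :
  is_vderive f t l -> is_vderive g t m ->
  is_derive (fun u => dot (f u) (g u)) t (dot l (g t) + dot (f t) m).
Proof.
  intros (Fx & Fy & Fz) (Gx & Gy & Gz). unfold dot. eapply is_derive_eq.
  - apply is_derive_Rplus; [apply is_derive_Rplus|]; apply is_derive_Rmult; eassumption.
  - cbv beta. ring.
Qed.

Lemma is_vderive_scal (a : R -> R) f t a' l :
  is_derive a t a' -> is_vderive f t l ->
  is_vderive (fun u => scal (a u) (f u)) t (plus (scal a' (f t)) (scal (a t) l)).
Proof.
  intros Ha (Fx & Fy & Fz). split; [|split]; now apply is_derive_Rmult.
Qed.

Lemma is_vderive_comp f (h : R -> R) t l m :
  is_vderive f (h t) l -> is_derive h t m ->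
  is_vderive (fun u => f (h u)) t (scal m l).
Proof.
  intros (Fx & Fy & Fz) Hh.
  split; [|split].
  - exact (is_derive_comp (fun u => vx (f u)) h t _ _ Fx Hh).
  - exact (is_derive_comp (fun u => vy (f u)) h t _ _ Fy Hh).
  - exact (is_derive_comp (fun u => vz (f u)) h t _ _ Fz Hh).
Qed.

Ltac vec_unfold :=
  unfold dot;
  repeat match goal with
  | |- context [vx (plus ?p ?q)] => change (vx (plus p q)) with (vx p + vx q)
  | |- context [vy (plus ?p ?q)] => change (vy (plus p q)) with (vy p + vy q)
  | |- context [vz (plus ?p ?q)] => change (vz (plus p q)) with (vz p + vz q)
  | |- context [vx (scal ?a ?p)] => change (vx (scal a p)) with (a * vx p)
  | |- context [vy (scal ?a ?p)] => change (vy (scal a p)) with (a * vy p)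
  | |- context [vz (scal ?a ?p)] => change (vz (scal a p)) with (a * vz p)
  | |- context [vx (cross ?p ?q)] =>
      change (vx (cross p q)) with (vy p * vz q - vz p * vy q)
  | |- context [vy (cross ?p ?q)] =>
      change (vy (cross p q)) with (vz p * vx q - vx p * vz q)
  | |- context [vz (cross ?p ?q)] =>
      change (vz (cross p q)) with (vx p * vy q - vy p * vx q)
  | |- context [vx (?a, ?b, ?c)] => change (vx (a, b, c)) with a
  | |- context [vy (?a, ?b, ?c)] => change (vy (a, b, c)) with b
  | |- context [vz (?a, ?b, ?c)] => change (vz (a, b, c)) with c
  end.
Ltac vec_ring := apply vec_ext; vec_unfold; ring.

(** Coordinates of w in the orthogonal basis u, v, u x v, multiplied by the common
    squared length of the last two vectors to avoid denominators.  The identity in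
    the proof holds for all u and v; it comes from expanding n x (n x w) with n = u
    x v in two ways. *)
Lemma cross_expansion (u v w : vec3) :
  dot u u = 1 -> dot u v = 0 ->
  scal (dot v v) w =
  plus (scal (dot v v * dot u w) u)
    (plus (scal (dot v w) v) (scal (dot (cross u v) w) (cross u v))).
Proof.
  intros H1 H0.
  assert (E : scal (dot u u * dot v v - dot u v * dot u v) w =
    plus (scal (dot v v * dot u w - dot u v * dot v w) u)
     (plus (scal (dot u u * dot v w - dot u v * dot u w) v)
        (scal (dot (cross u v) w) (cross u v)))) by vec_ring.
  rewrite H1, H0 in E.
  replace (1 * dot v v - 0 * 0) with (dot v v) in E by ring.
  replace (dot v v * dot u w - 0 * dot v w) with (dot v v * dot u w) in E by ring.
  replace (1 * dot v w - 0 * dot u w) with (dot v w) in E by ring.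
  exact E.
Qed.

(** * Curves whose binormal indicatrix is given *)

Lemma is_derive_vnorm f t l :
  is_vderive f t l -> 0 < dot (f t) (f t) ->
  is_derive (fun u => vnorm (f u)) t (dot (f t) l / vnorm (f t)).
Proof.
  intros Hf Hp. unfold vnorm.
  assert (Hs : 0 < sqrt (dot (f t) (f t))) by now apply sqrt_lt_R0.
  eapply is_derive_eq.
  - apply (is_derive_comp sqrt (fun u => dot (f u) (f u)) t).
    + apply is_derive_Reals, derivable_pt_lim_sqrt, Hp.
    + apply is_derive_dot; eassumption.
  - unfold scal; simpl; unfold mult; simpl.
    replace (dot l (f t)) with (dot (f t) l) by (unfold dot; ring).
    field. lra.
Qed.

Lemma dot_self_nonneg (u : vec3) : 0 <= dot u u.
Proof. unfold dot. nra. Qed.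

Lemma vnorm_sqr (u : vec3) : vnorm u * vnorm u = dot u u.
Proof. apply sqrt_sqrt, dot_self_nonneg. Qed.

Lemma vnorm_scal (a : R) (u : vec3) : vnorm (scal a u) = Rabs a * vnorm u.
Proof.
  unfold vnorm. rewrite <- sqrt_Rsqr_abs, <- sqrt_mult_alt by apply Rle_0_sqr.
  f_equal. vec_unfold. unfold Rsqr. ring.
Qed.

Lemma dot_comm u v : dot u v = dot v u.
Proof. unfold dot. ring. Qed.

(** With r = |b'|, the Frenet frame of g is T = (b x b')/r, N = b'/r and -b.  Since
    b has length 1, b is orthogonal to b' and the scalar product of b and b'' is
    -r^2; expanding b'' in the basis b, b', b x b' then gives all the Frenet
    equations, with curvature -det(b, b', b'')/r^3, which the sign of the
    determinant makes positive.  The lower bound m on the speed makes the arclength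
    onto, so that all functions of t can be rewritten as functions of the arclength.
    *)
Lemma spherical_torsion_one (g b b1 b2 : R -> vec3) (m : R) :
  0 < m ->
  (forall t, is_vderive b t (b1 t)) ->
  (forall t, is_vderive b1 t (b2 t)) ->
  (forall t, is_vderive g t (cross (b t) (b1 t))) ->
  (forall t, dot (b t) (b t) = 1) ->
  (forall t, m <= vnorm (b1 t)) ->
  (forall t, dot (cross (b t) (b1 t)) (b2 t) < 0) ->
  exists kappa : R -> R,
    curvature_torsion g kappa (fun _ => 1) /\ forall s, 0 < kappa s.
Proof.
  intros m0 D1 D2 Dg U Hm Hdet.
  assert (O : forall t, dot (b t) (b1 t) = 0).
  { intros t.
    assert (E : dot (b1 t) (b t) + dot (b t) (b1 t) = 0).
    { rewrite <- (is_derive_unique _ _ _ (is_derive_dot b b t _ _ (D1 t) (D1 t))).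
      rewrite <- (Derive_const 1 t). now apply Derive_ext. }
    rewrite dot_comm in E. lra. }
  set (rho := fun t => vnorm (b1 t)) in *.
  assert (P : forall t, 0 < rho t) by (intros t; specialize (Hm t); unfold rho; lra).
  assert (Q : forall t, dot (b1 t) (b1 t) = rho t * rho t)
    by (intros t; symmetry; apply vnorm_sqr).
  assert (O2 : forall t, dot (b t) (b2 t) = - (rho t * rho t)).
  { intros t.
    assert (E : dot (b1 t) (b1 t) + dot (b t) (b2 t) = 0).
    { rewrite <- (is_derive_unique _ _ _ (is_derive_dot b b1 t _ _ (D1 t) (D2 t))).
      rewrite <- (Derive_const 0 t). now apply Derive_ext. }
    rewrite Q in E. lra. }
  assert (Drho : forall t, is_derive rho t (dot (b1 t) (b2 t) / rho t)).
  { intros t. apply is_derive_vnorm; [apply D2|]. rewrite Q.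
    specialize (P t). nra. }
  (* g has the same speed as b, because b x b' has length |b'| (Lagrange's
     identity). *)
  assert (Dsig : forall t, is_derive (fun t => arclength g t) t (rho t)).
  { intros t.
    apply is_derive_ext with (f := fun t => RInt rho 0 t).
    - intros x. apply RInt_ext. intros u _. unfold rho.
      rewrite (vDerive_unique g u _ (Dg u)). unfold vnorm. f_equal.
      transitivity (dot (b u) (b u) * dot (b1 u) (b1 u)
                      - dot (b u) (b1 u) * dot (b u) (b1 u)).
      + rewrite U, O. ring.
      + vec_unfold. ring.
    - assert (Cr : forall x, continuous rho x)
        by (intros x; apply (ex_derive_continuous rho); eexists; apply Drho).
      apply (is_derive_RInt rho (fun t => RInt rho 0 t) 0 t); [|apply Cr].
      apply filter_forall. intros x. apply (RInt_correct rho).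
      apply (ex_RInt_continuous rho). intros; apply Cr. }
  destruct (inverse_of_derive_bound _ _ m m0 Dsig Hm) as (tau & L & _ & Dtau).
  set (det := fun t => dot (cross (b t) (b1 t)) (b2 t)) in *.
  assert (Hdet' : forall t, det t < 0) by exact Hdet. clear Hdet.
  set (T := fun t => scal (/ rho t) (cross (b t) (b1 t)) : vec3).
  set (N := fun t => scal (/ rho t) (b1 t) : vec3).
  set (K := fun t => - det t / (rho t * rho t * rho t)).
  assert (KP : forall t, 0 < K t).
  { intros t. unfold K. specialize (P t). specialize (Hdet' t).
    apply Rdiv_lt_0_compat; [lra|]. repeat apply Rmult_lt_0_compat; lra. }
  assert (Dinv : forall t, is_derive (fun u => / rho u) t
                   (- (dot (b1 t) (b2 t) / rho t) / (rho t ^ 2))).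
  { intros t. apply is_derive_inv; [apply Drho|]. specialize (P t). lra. }
  assert (X : forall t, b2 t =
     plus (scal (- (rho t * rho t)) (b t))
       (plus (scal (dot (b1 t) (b2 t) / (rho t * rho t)) (b1 t))
          (scal (det t / (rho t * rho t)) (cross (b t) (b1 t))))).
  { intros t. pose proof (cross_expansion (b t) (b1 t) (b2 t) (U t) (O t)) as E.
    fold (det t) in E. rewrite Q, O2 in E. specialize (P t).
    transitivity (scal (/ (rho t * rho t)) (scal (rho t * rho t) (b2 t))).
    - apply vec_ext; vec_unfold; field; lra.
    - rewrite E. apply vec_ext; vec_unfold; field; lra. }
  assert (X2 : forall t, cross (b t) (b2 t) =
     plus (scal (dot (b1 t) (b2 t) / (rho t * rho t)) (cross (b t) (b1 t)))
       (scal (- det t / (rho t * rho t)) (b1 t))).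
  { intros t.
    assert (E : cross (b t) (cross (b t) (b1 t)) =
                plus (scal (dot (b t) (b1 t)) (b t))
                  (scal (- dot (b t) (b t)) (b1 t))) by vec_ring.
    rewrite U, O in E. rewrite (X t) at 1.
    set (be := dot (b1 t) (b2 t)). clearbody be det.
    transitivity (plus (scal (be / (rho t * rho t)) (cross (b t) (b1 t)))
      (scal (det t / (rho t * rho t)) (cross (b t) (cross (b t) (b1 t)))));
      [vec_ring|].
    rewrite E. apply vec_ext; vec_unfold; field; specialize (P t); lra. }
  assert (DT : forall t, is_vderive T t (scal (rho t * K t) (N t))).
  { intros t.
    eapply is_vderive_eq.
    - exact (is_vderive_scal _ _ t _ _ (Dinv t)
               (is_vderive_cross b b1 t _ _ (D1 t) (D2 t))).
    - rewrite X2. unfold K, N. set (be := dot (b1 t) (b2 t)). clearbody be det.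
      specialize (P t). clearbody rho.
      apply vec_ext; vec_unfold; field; lra. }
  assert (DN : forall t, is_vderive N t
             (plus (scal (- (rho t * K t)) (T t)) (scal (- rho t) (b t)))).
  { intros t.
    eapply is_vderive_eq.
    - exact (is_vderive_scal _ _ t _ _ (Dinv t) (D2 t)).
    - rewrite (X t) at 2. unfold K, T. set (be := dot (b1 t) (b2 t)).
      clearbody be det. specialize (P t). clearbody rho.
      apply vec_ext; vec_unfold; field; lra. }
  assert (NN : forall t, dot (N t) (N t) = 1).
  { intros t. specialize (P t). specialize (Q t). unfold N.
    transitivity (/ rho t * / rho t * dot (b1 t) (b1 t));
      [vec_unfold; ring|rewrite Q; field; lra]. }
  exists (fun s => K (tau s)). split; [|intros s; apply KP].
  exists (fun s => g (tau s)), (fun s => T (tau s)), (fun s => N (tau s)),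
    (fun s => scal (-1) (b (tau s))).
  split; [intros t; now rewrite L|].
  intros s. specialize (Dtau s). set (t := tau s) in *.
  specialize (P t). specialize (KP t).
  assert (DTs : is_vderive (fun s => T (tau s)) s (scal (K t) (N t))).
  { eapply is_vderive_eq; [exact (is_vderive_comp T tau s _ _ (DT t) Dtau)|].
    apply vec_ext; vec_unfold; field; lra. }
  split; [|split; [|split; [|split; [|split]]]].
  - assert (BN : dot (b t) (N t) = 0).
    { unfold N. transitivity (/ rho t * dot (b t) (b1 t));
        [vec_unfold; ring|rewrite O; ring]. }
    assert (TE : T t = cross (b t) (N t)) by (unfold T, N; vec_ring).
    specialize (U t). specialize (NN t). rewrite TE. clearbody N.
    assert (CC : dot (cross (b t) (N t)) (cross (b t) (N t)) = 1).
    { transitivity (dot (b t) (b t) * dot (N t) (N t) - dot (b t) (N t) * dot (b t) (N t));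
        [vec_unfold; ring|rewrite U, NN, BN; ring]. }
    repeat apply conj.
    + exact CC.
    + exact NN.
    + transitivity (dot (b t) (b t)); [vec_unfold; ring|exact U].
    + vec_unfold. ring.
    + vec_unfold. ring.
    + transitivity (- dot (b t) (N t)); [vec_unfold; ring|rewrite BN; ring].
    + apply Rlt_le_trans with 1; [lra|]. right.
      transitivity (dot (b t) (b t) * dot (N t) (N t) - dot (b t) (N t) * dot (b t) (N t));
        [rewrite U, NN, BN; ring|vec_unfold; ring].
  - apply is_derive_vec.
    exact (is_vderive_comp g tau s _ _ (Dg t) Dtau).
  - now apply is_derive_vec.
  - apply is_derive_vec.
    eapply is_vderive_eq; [exact (is_vderive_comp N tau s _ _ (DN t) Dtau)|].
    apply vec_ext; vec_unfold; field; lra.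
  - apply is_derive_vec. eapply is_vderive_eq.
    + exact (is_vderive_scal (fun _ => -1) (fun s => b (tau s)) s 0 _
               (is_derive_const _ _) (is_vderive_comp b tau s _ _ (D1 t) Dtau)).
    + fold t. unfold N. apply vec_ext; vec_unfold; ring.
  - rewrite (vDerive_unique _ _ _ DTs), vnorm_scal.
    unfold vnorm. rewrite NN, sqrt_1, Rabs_pos_eq; lra.
Qed.

(** * The frame (U, V, W) *)

Definition frame (p : vec3) : vec3 :=
  plus (scal (vx p) Uvec) (plus (scal (vy p) Vvec) (scal (vz p) Wvec)).

Definition coframe (q : vec3) : vec3 := (dot q Uvec, dot q Vvec, dot q Wvec).

Lemma inv_sqrt_sqr (n : R) : 0 < n -> / sqrt n * / sqrt n = / n.
Proof. intros Hn. rewrite <- Rinv_mult, sqrt_sqrt; lra. Qed.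

(** The entries of U, V, W are polynomials in u = 1/sqrt 3 and v = 1/sqrt 6, so that
    every identity about the frame follows from 3 u^2 = 1 and 6 v^2 = 1. *)
Lemma frame_explicit : exists u v : R,
  u = / sqrt 3 /\ 3 * (u * u) = 1 /\ 6 * (v * v) = 1 /\
  Uvec = (u, u, u) /\ Vvec = (- v, - v, 2 * v) /\
  Wvec = (3 * (u * v), - 3 * (u * v), 0).
Proof.
  exists (/ sqrt 3), (/ sqrt 6).
  split; [reflexivity|]. split; [rewrite inv_sqrt_sqr; lra|].
  split; [rewrite inv_sqrt_sqr; lra|]. unfold Wvec, Uvec, Vvec.
  split; [|split]; apply vec_ext; vec_unfold; unfold Rdiv; ring.
Qed.

Lemma cross_frame (p q : vec3) : cross (frame p) (frame q) = frame (cross p q).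
Proof.
  destruct frame_explicit as (u & v & _ & Hu & Hv & EU & EV & EW).
  unfold frame. rewrite EU, EV, EW. clear EU EV EW.
  apply vec_ext; vec_unfold; nsatz.
Qed.

Lemma dot_frame (p q : vec3) : dot (frame p) (frame q) = dot p q.
Proof.
  destruct frame_explicit as (u & v & _ & Hu & Hv & EU & EV & EW).
  unfold frame. rewrite EU, EV, EW. clear EU EV EW. vec_unfold. nsatz.
Qed.

Lemma coframe_frame (p : vec3) : coframe (frame p) = p.
Proof.
  destruct frame_explicit as (u & v & _ & Hu & Hv & EU & EV & EW).
  unfold coframe, frame. rewrite EU, EV, EW. clear EU EV EW.
  apply vec_ext; vec_unfold; nsatz.
Qed.

Lemma frame_coframe (q : vec3) : frame (coframe q) = q.
Proof.
  destruct frame_explicit as (u & v & _ & Hu & Hv & EU & EV & EW).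
  unfold coframe, frame. rewrite EU, EV, EW. clear EU EV EW.
  apply vec_ext; vec_unfold; nsatz.
Qed.

Lemma is_vderive_frame f t l :
  is_vderive f t l -> is_vderive (fun u => frame (f u)) t (frame l).
Proof.
  intros (Fx & Fy & Fz).
  assert (H : forall a b c : R,
    is_derive (fun u => vx (f u) * a + (vy (f u) * b + vz (f u) * c)) t
      (vx l * a + (vy l * b + vz l * c))).
  { intros a b c.
    apply is_derive_Rplus; [|apply is_derive_Rplus];
      now apply @is_derive_scal_l with (V := R_NormedModule). }
  split; [|split]; apply H.
Qed.

Lemma continuous_frame {U : UniformSpace} (h : U -> vec3) (u : U) :
  continuous h u -> continuous (fun w => frame (h w)) u.
Proof.
  intros H. destruct (continuous_coords h u H) as (Hx & Hy & Hz).
  assert (HH : forall a b c : R,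
    continuous (fun w => vx (h w) * a + (vy (h w) * b + vz (h w) * c)) u)
    by (intros; continuous_tac).
  apply (continuous_triple (fun w => vx (frame (h w))) (fun w => vy (frame (h w)))
           (fun w => vz (frame (h w)))); apply HH.
Qed.

Lemma continuous_coframe {U : UniformSpace} (h : U -> vec3) (u : U) :
  continuous h u -> continuous (fun w => coframe (h w)) u.
Proof.
  intros H. destruct (continuous_coords h u H) as (Hx & Hy & Hz).
  unfold coframe, dot. continuous_tac.
Qed.

(** * Rotations about the first axis *)

Definition rotate (t : R) (p : vec3) : vec3 :=
  (vx p, cos t * vy p - sin t * vz p, sin t * vy p + cos t * vz p).

Lemma cross_rotate t p q : cross (rotate t p) (rotate t q) = rotate t (cross p q).
Proof.
  pose proof (cos_sqr_plus_sin_sqr t) as E.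
  assert (E' : cos t * cos t = 1 - sin t * sin t) by lra.
  unfold rotate. apply vec_ext; vec_unfold; ring [E'].
Qed.

Lemma dot_rotate t p q : dot (rotate t p) (rotate t q) = dot p q.
Proof.
  pose proof (cos_sqr_plus_sin_sqr t) as E.
  assert (E' : cos t * cos t = 1 - sin t * sin t) by lra.
  unfold rotate. vec_unfold; ring [E'].
Qed.

(** In a frame that turns with unit speed, the velocity is the relative velocity l
    plus e1 x f. *)
Lemma is_vderive_rotate f t l :
  is_vderive f t l ->
  is_vderive (fun u => rotate u (f u)) t
    (rotate t (plus l (0, - vz (f t), vy (f t)))).
Proof.
  intros (Fx & Fy & Fz).
  split; [|split].
  - eapply is_derive_eq; [exact Fx|]. unfold rotate. vec_unfold. ring.
  - eapply is_derive_eq.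
    + apply is_derive_Rminus; apply is_derive_Rmult;
        [apply is_derive_cos|exact Fy|apply is_derive_sin|exact Fz].
    + unfold rotate. vec_unfold. ring.
  - eapply is_derive_eq.
    + apply is_derive_Rplus; apply is_derive_Rmult;
        [apply is_derive_sin|exact Fy|apply is_derive_cos|exact Fz].
    + unfold rotate. vec_unfold. ring.
Qed.

(** * The epicycle in the frame *)

Definition mulv (M : mat3) (v : vec3) : vec3 :=
  (coeff_mat 0 M 0 0 * vx v + coeff_mat 0 M 0 1 * vy v + coeff_mat 0 M 0 2 * vz v,
   coeff_mat 0 M 1 0 * vx v + coeff_mat 0 M 1 1 * vy v + coeff_mat 0 M 1 2 * vz v,
   coeff_mat 0 M 2 0 * vx v + coeff_mat 0 M 2 1 * vy v + coeff_mat 0 M 2 2 * vz v).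

Lemma coeff_Mmult (A B : mat3) (i j : nat) : (i < 3)%nat -> (j < 3)%nat ->
  coeff_mat 0 (Mmult A B) i j =
  coeff_mat 0 A i 0 * coeff_mat 0 B 0 j + coeff_mat 0 A i 1 * coeff_mat 0 B 1 j
  + coeff_mat 0 A i 2 * coeff_mat 0 B 2 j.
Proof.
  intros Hi Hj. unfold Mmult.
  rewrite (coeff_mat_bij 0 _ i j Hi Hj). simpl pred.
  now rewrite !sum_Sn, sum_O.
Qed.

Lemma mulv_Mmult (A B : mat3) (v : vec3) : mulv (Mmult A B) v = mulv A (mulv B v).
Proof.
  unfold mulv. rewrite !coeff_Mmult by lia. apply vec_ext; vec_unfold; ring.
Qed.

Lemma first_column_Mmult (A B : mat3) :
  first_column (Mmult A B) = mulv A (first_column B).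
Proof.
  unfold first_column, mulv. rewrite !coeff_Mmult by lia.
  apply vec_ext; vec_unfold; ring.
Qed.

Lemma mulv_Mplus (A B : mat3) (v : vec3) :
  mulv (Mplus A B) v = plus (mulv A v) (mulv B v).
Proof.
  assert (E : forall i j, (i < 3)%nat -> (j < 3)%nat ->
    coeff_mat 0 (Mplus A B) i j = coeff_mat 0 A i j + coeff_mat 0 B i j).
  { intros i j Hi Hj. exact (coeff_mat_bij 0 _ i j Hi Hj). }
  unfold mulv. rewrite !E by lia.
  apply vec_ext; vec_unfold; ring.
Qed.

Lemma mulv_mscal (a : R) (A : mat3) (v : vec3) :
  mulv (mscal a A) v = scal a (mulv A v).
Proof.
  unfold mulv, mscal. rewrite !(coeff_mat_bij 0) by lia.
  apply vec_ext; vec_unfold; ring.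
Qed.

Lemma mulv_Mone (v : vec3) : mulv Mone v = v.
Proof.
  unfold mulv, Mone. rewrite !(coeff_mat_bij 0) by lia.
  unfold Mone_seq, zero, one. simpl. apply vec_ext; vec_unfold; ring.
Qed.

Lemma mulv_Cmat (p : vec3) : mulv Cmat p = frame p.
Proof.
  unfold Cmat, of_columns, mulv, frame. simpl.
  apply vec_ext; vec_unfold; unfold coeff_mat; simpl; ring.
Qed.

(** The matrix Ubar is the cross product by U, which sends V to W and W to -V. *)
Lemma mulv_Ubar_frame (p : vec3) :
  mulv Ubar (frame p) = frame (0, - vz p, vy p).
Proof.
  destruct frame_explicit as (u & v & E & Hu & Hv & EU & EV & EW).
  unfold Ubar. rewrite mulv_mscal. unfold frame. rewrite EU, EV, EW. clear EU EV EW.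
  replace (1 / sqrt 3) with u by (rewrite E; field; apply Rgt_not_eq, sqrt_lt_R0; lra).
  unfold mulv, coeff_mat; simpl.
  apply vec_ext; vec_unfold; nsatz.
Qed.

Lemma mulv_Qmat_frame (t : R) (p : vec3) : mulv (Qmat t) (frame p) = frame (rotate t p).
Proof.
  unfold Qmat. rewrite !mulv_Mplus, !mulv_mscal, mulv_Mone, mulv_Mmult.
  rewrite !mulv_Ubar_frame. unfold rotate, frame.
  apply vec_ext; vec_unfold; ring.
Qed.

Lemma mulv_Smat (a : R) (p : vec3) :
  mulv (Smat a) p = (cos a * vx p - sin a * vy p, sin a * vx p + cos a * vy p, vz p).
Proof.
  unfold mulv, coeff_mat, Smat; simpl. apply vec_ext; vec_unfold; ring.
Qed.

Lemma mulv_Rmat (a : R) (p : vec3) :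
  mulv (Rmat a) p = (vx p, cos a * vy p - sin a * vz p, sin a * vy p + cos a * vz p).
Proof.
  unfold mulv, coeff_mat, Rmat; simpl. apply vec_ext; vec_unfold; ring.
Qed.

Lemma epicycle_frame (m n : Z) (a be t : R) :
  epicycle m n a be t =
  frame (rotate (IZR m * t)
    (cos a * cos be - sin a * (cos (IZR n * t) * sin be),
     sin a * cos be + cos a * (cos (IZR n * t) * sin be),
     sin (IZR n * t) * sin be)).
Proof.
  unfold epicycle. rewrite first_column_Mmult, !mulv_Mmult, mulv_Cmat.
  replace (first_column (Smat be)) with ((cos be, sin be, 0) : vec3) by reflexivity.
  rewrite mulv_Rmat, mulv_Smat, mulv_Qmat_frame.
  f_equal. f_equal. apply vec_ext; vec_unfold; ring.
Qed.

(** * The radius beta *)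

(** cot beta and sin beta, see [angle_beta]. *)
Definition cotb : R := sqrt (3 * sqrt 2 - 3 / 2).
Definition sinb : R := sqrt (/ (3 * sqrt 2 - / 2)).

Lemma sqrt2_bounds : 1414 / 1000 < sqrt 2 < 1415 / 1000.
Proof.
  split.
  - rewrite <- (sqrt_square (1414 / 1000)) by lra. apply sqrt_lt_1; lra.
  - rewrite <- (sqrt_square (1415 / 1000)) by lra. apply sqrt_lt_1; lra.
Qed.

Lemma sqrt2_sqr : sqrt 2 * sqrt 2 = 2.
Proof. apply sqrt_sqrt. lra. Qed.

Lemma cotb_sqr : cotb * cotb = 3 * sqrt 2 - 3 / 2.
Proof. apply sqrt_sqrt. pose proof sqrt2_bounds. lra. Qed.

Lemma cotb_bounds : 1655 / 1000 < cotb < 1657 / 1000.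
Proof.
  pose proof sqrt2_bounds. pose proof cotb_sqr.
  assert (0 <= cotb) by apply sqrt_pos. nra.
Qed.

(** Doubling cotb makes the coefficients of its quadratic relation integers, so that
    the field tactic can rewrite with it. *)
Lemma scaled_cotb : exists k, cotb = k / 2 /\ k * k = 12 * sqrt 2 - 6.
Proof.
  exists (2 * cotb). pose proof cotb_sqr. split; [field|lra].
Qed.

Lemma sinb_sqr : sinb * sinb * (3 * sqrt 2 - / 2) = 1.
Proof.
  pose proof sqrt2_bounds. unfold sinb. rewrite sqrt_sqrt.
  - field. lra.
  - left. apply Rinv_0_lt_compat. lra.
Qed.

Lemma sinb_pos : 0 < sinb.
Proof.
  apply sqrt_lt_R0, Rinv_0_lt_compat. pose proof sqrt2_bounds. lra.
Qed.

(** The value of cos (2 beta) gives sin beta ^2 = (2 + 12 sqrt 2)/71, which is the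
    inverse of 3 sqrt 2 - 1/2. *)
Lemma angle_beta :
  let be := / 2 * acos ((67 - 24 * sqrt 2) / 71) in
  sin be = sinb /\ cos be = cotb * sinb.
Proof.
  intros be. pose proof sqrt2_bounds as Hr. pose proof sqrt2_sqr as Hq.
  set (x := (67 - 24 * sqrt 2) / 71) in *.
  assert (Hx : -1 <= x <= 1) by (unfold x; lra).
  pose proof (acos_bound x) as Hb. pose proof PI_RGT_0.
  assert (Hbe : 0 <= be <= PI / 2) by (unfold be; lra).
  assert (E : cos (2 * be) = x).
  { unfold be. replace (2 * (/ 2 * acos x)) with (acos x) by field.
    now apply cos_acos. }
  assert (Ps : 0 <= sin be) by (apply sin_ge_0; lra).
  assert (Pc : 0 <= cos be) by (apply cos_ge_0; lra).
  pose proof (cos_sqr_plus_sin_sqr be) as U. rewrite cos_2a in E.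
  pose proof sinb_sqr as S. pose proof sinb_pos as Sp.
  pose proof cotb_sqr as K. pose proof cotb_bounds as Kb.
  assert (S1 : sinb * sinb = (2 + 12 * sqrt 2) / 71).
  { apply Rmult_eq_reg_r with (3 * sqrt 2 - / 2); [|lra]. rewrite S. nra. }
  assert (Es : sin be = sinb).
  { apply Rsqr_inj; [exact Ps|lra|]. unfold Rsqr. rewrite S1. unfold x in E. lra. }
  split; [exact Es|].
  apply Rsqr_inj; [exact Pc|nra|]. unfold Rsqr.
  transitivity (cotb * cotb * (sinb * sinb)); [|ring].
  rewrite K, S1. unfold x in E.
  replace ((3 * sqrt 2 - 3 / 2) * ((2 + 12 * sqrt 2) / 71))
    with ((36 * (sqrt 2 * sqrt 2) - 12 * sqrt 2 - 3) / 71) by field.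
  rewrite Hq. lra.
Qed.

(** * The spherical curve and its integral *)

(** The position, the velocity and the acceleration of the epicycle, in the frame
    that turns with angle t about U, as functions of q = 3t. *)
Definition profile (q : R) : vec3 :=
  (sinb * (sqrt 2 / 2 * (cotb - cos q)), sinb * (sqrt 2 / 2 * (cotb + cos q)),
   - (sinb * sin q)).
Definition profile_vel (q : R) : vec3 :=
  (sinb * (3 * (sqrt 2 / 2) * sin q), sinb * ((1 - 3 * (sqrt 2 / 2)) * sin q),
   sinb * (sqrt 2 / 2 * cotb + (sqrt 2 / 2 - 3) * cos q)).
Definition profile_acc (q : R) : vec3 :=
  (sinb * (9 * (sqrt 2 / 2) * cos q),
   sinb * (- (sqrt 2 / 2 * cotb) + (6 - 10 * (sqrt 2 / 2)) * cos q),
   sinb * ((10 - 6 * (sqrt 2 / 2)) * sin q)).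

Lemma epicycle_profile (t : R) :
  epicycle 1 (-3) (PI / 4) (/ 2 * acos ((67 - 24 * sqrt 2) / 71)) t =
  frame (rotate t (profile (3 * t))).
Proof.
  destruct angle_beta as [Es Ec]. rewrite epicycle_frame, Es, Ec.
  assert (E2 : 1 / sqrt 2 = sqrt 2 / 2).
  { pose proof sqrt2_sqr. pose proof sqrt2_bounds.
    apply Rmult_eq_reg_r with (sqrt 2); [|lra].
    replace (1 / sqrt 2 * sqrt 2) with 1 by (field; lra). lra. }
  rewrite cos_PI4, sin_PI4, E2, Rmult_1_l.
  replace (-3 * t) with (- (3 * t)) by ring. rewrite cos_neg, sin_neg.
  do 2 f_equal. unfold profile. apply vec_ext; vec_unfold; ring.
Qed.

Ltac vderive_tac :=
  split; [|split]; unfold vx, vy, vz; simpl; auto_derive;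
  [exact I|ring|exact I|ring|exact I|ring].

Lemma is_vderive_profile t :
  is_vderive (fun t => rotate t (profile (3 * t))) t (rotate t (profile_vel (3 * t))).
Proof.
  eapply is_vderive_eq.
  - apply is_vderive_rotate with (l := (sinb * (sqrt 2 / 2 * (3 * sin (3 * t))),
      - (sinb * (sqrt 2 / 2 * (3 * sin (3 * t)))), - (sinb * (3 * cos (3 * t))))).
    unfold profile. vderive_tac.
  - f_equal. unfold profile, profile_vel. apply vec_ext; vec_unfold; ring.
Qed.

Lemma is_vderive_profile_vel t :
  is_vderive (fun t => rotate t (profile_vel (3 * t))) t (rotate t (profile_acc (3 * t))).
Proof.
  eapply is_vderive_eq.
  - apply is_vderive_rotate with (l := (sinb * (3 * (sqrt 2 / 2) * (3 * cos (3 * t))),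
      sinb * ((1 - 3 * (sqrt 2 / 2)) * (3 * cos (3 * t))),
      - (sinb * ((sqrt 2 / 2 - 3) * (3 * sin (3 * t)))))).
    unfold profile_vel. vderive_tac.
  - f_equal. unfold profile_vel, profile_acc. apply vec_ext; vec_unfold; ring.
Qed.

(** Up to an additive constant, the V- and W-components of gamma / sin beta ^2 are
    the real and imaginary parts of i exp(it) v(3t), where v = lobe_re + i lobe_im,
    and its U-component is - depth (3t).  These functions come from integrating the
    Fourier expansion of B x B' term by term: exp(it) exp(ikq) has primitive exp(it)
    exp(ikq) / (i (1 + 3k)), which explains the denominators.  Double angles are
    expanded. *)
Definition depth (q : R) : R :=
  cotb * (3 * sqrt 2 - 2) / 6 * sin q + sin q * cos q / 12.
Definition lobe_re (q : R) : R :=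
  (3 * sqrt 2 - 1) + 9 / 8 * cotb * cos q
  + (6 * sqrt 2 + 1) / 140 * (2 * cos q ^ 2 - 1).
Definition lobe_im (q : R) : R :=
  - (cotb * (3 + 4 * sqrt 2) / 8 * sin q) - (sqrt 2 + 6) / 70 * (sin q * cos q).
Definition depth' (q : R) : R :=
  cotb * (3 * sqrt 2 - 2) / 6 * cos q + (2 * cos q ^ 2 - 1) / 12.
Definition lobe_re' (q : R) : R :=
  - (9 / 8 * cotb * sin q) - (6 * sqrt 2 + 1) / 35 * (sin q * cos q).
Definition lobe_im' (q : R) : R :=
  - (cotb * (3 + 4 * sqrt 2) / 8 * cos q) - (sqrt 2 + 6) / 70 * (2 * cos q ^ 2 - 1).

Lemma sin_sqr (q : R) : sin q * sin q = 1 - cos q * cos q.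
Proof. pose proof (cos_sqr_plus_sin_sqr q). lra. Qed.

Lemma is_derive_depth t : is_derive (fun t => depth (3 * t)) t (3 * depth' (3 * t)).
Proof.
  unfold depth, depth'. auto_derive; [exact I|]. pose proof (sin_sqr (3 * t)) as E.
  field [E].
Qed.
Lemma is_derive_lobe_re t : is_derive (fun t => lobe_re (3 * t)) t (3 * lobe_re' (3 * t)).
Proof. unfold lobe_re, lobe_re'. auto_derive; [exact I|]. simpl. field. Qed.
Lemma is_derive_lobe_im t : is_derive (fun t => lobe_im (3 * t)) t (3 * lobe_im' (3 * t)).
Proof.
  unfold lobe_im, lobe_im'. auto_derive; [exact I|]. pose proof (sin_sqr (3 * t)) as E.
  field [E].
Qed.

Definition model (t : R) : vec3 :=
  rotate t (- depth (3 * t), - lobe_im (3 * t), lobe_re (3 * t)).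

(** This is where the value of beta matters: the relation cotb^2 = 3 sqrt 2 - 3/2 is
    what cancels the constant term of the first component of the cross product. *)
Lemma is_vderive_model t :
  is_vderive (fun t => scal (sinb * sinb) (model t)) t
    (cross (rotate t (profile (3 * t))) (rotate t (profile_vel (3 * t)))).
Proof.
  eapply is_vderive_eq.
  - apply is_vderive_scal with (a := fun _ => sinb * sinb) (a' := 0).
    + apply @is_derive_const.
    + apply is_vderive_rotate with
        (l := (- (3 * depth' (3 * t)), - (3 * lobe_im' (3 * t)), 3 * lobe_re' (3 * t))).
      split; [|split].
      * apply (@is_derive_opp R_AbsRing R_NormedModule), is_derive_depth.
      * apply (@is_derive_opp R_AbsRing R_NormedModule), is_derive_lobe_im.
      * apply is_derive_lobe_re.
  - rewrite cross_rotate.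
    pose proof (sin_sqr (3 * t)) as Es. pose proof sqrt2_sqr as Er.
    destruct scaled_cotb as (k & Ec & Ek).
    transitivity (rotate t (scal (sinb * sinb)
       (plus ((- (3 * depth' (3 * t)), - (3 * lobe_im' (3 * t)), 3 * lobe_re' (3 * t)) : vec3)
        ((0, - lobe_re (3 * t), - lobe_im (3 * t)) : vec3)))).
    + unfold model, rotate. apply vec_ext; vec_unfold; ring.
    + f_equal. unfold depth', lobe_re', lobe_im', lobe_re, lobe_im, profile, profile_vel.
      set (C := cos (3 * t)) in *. set (S := sin (3 * t)) in *.
      set (r := sqrt 2) in *. rewrite Ec.
      clearbody C S r.
      apply vec_ext; vec_unfold; field [Es Er Ek].
Qed.

(** * Polynomial inequalities in cos 3t *)

Lemma product_bound (b x M : R) : 0 <= b <= M -> -1 <= x <= 1 -> - M <= b * x <= M.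
Proof. intros; split; nra. Qed.

Lemma profile_unit q : dot (profile q) (profile q) = 1.
Proof.
  transitivity (sinb * sinb * (3 * sqrt 2 - / 2)); [|apply sinb_sqr].
  pose proof (sin_sqr q) as Es. pose proof sqrt2_sqr as Er.
  destruct scaled_cotb as (k & E & Ek).
  unfold profile. vec_unfold. rewrite E. field [Es Er Ek].
Qed.

(** In the inequalities below, each quantity is written as a polynomial in C = cos
    q, after reduction by sin^2 = 1 - C^2, sqrt 2 ^2 = 2 and cotb^2 = 3 sqrt 2 -
    3/2.  In each lower bound, on [-1, 1], the constant term and, in [winding_pos],
    the quadratic one dominate the others, so three-digit bounds on sqrt 2 and cotb
    suffice. *)
Lemma profile_speed q : sinb * sinb / 4 <= dot (profile_vel q) (profile_vel q).
Proof.
  set (C := cos q).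
  assert (E : dot (profile_vel q) (profile_vel q) = sinb * sinb *
    ((37 / 4 - 3 / 2 * sqrt 2) - cotb * (3 * sqrt 2 - 1) * C - / 2 * (C * C))).
  { pose proof (sin_sqr q) as Es. pose proof sqrt2_sqr as Er.
    destruct scaled_cotb as (k & E & Ek).
    unfold profile_vel, C. vec_unfold. rewrite E. field [Es Er Ek]. }
  rewrite E. unfold Rdiv. apply Rmult_le_compat_l; [pose proof sinb_pos; nra|].
  pose proof (COS_bound q) as HC. fold C in HC.
  pose proof sqrt2_bounds as Hr. pose proof cotb_bounds as Hk.
  assert (H1 : 0 <= cotb * (3 * sqrt 2 - 1) <= 54 / 10) by nra.
  pose proof (product_bound _ _ _ H1 HC). assert (C * C <= 1) by nra. lra.
Qed.

Lemma profile_det q : dot (cross (profile q) (profile_vel q)) (profile_acc q) < 0.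
Proof.
  set (C := cos q).
  assert (E : dot (cross (profile q) (profile_vel q)) (profile_acc q) = - (sinb * sinb * sinb *
    (cotb * (30 - 109 / 8 * sqrt 2) + (241 / 8 * sqrt 2 - 159 / 4) * C
     - cotb * (9 / 2 - 3 / 4 * sqrt 2) * (C * C) - / 4 * sqrt 2 * (C * C * C)))).
  { pose proof (sin_sqr q) as Es. pose proof sqrt2_sqr as Er.
    destruct scaled_cotb as (k & E & Ek).
    unfold profile, profile_vel, profile_acc, C. vec_unfold. rewrite E. field [Es Er Ek]. }
  rewrite E. apply Ropp_lt_gt_0_contravar. pose proof sinb_pos as Ps.
  repeat apply Rmult_lt_0_compat; try exact Ps.
  pose proof (COS_bound q) as HC. fold C in HC.
  pose proof sqrt2_bounds as Hr. pose proof cotb_bounds as Hk.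
  assert (17 <= cotb * (30 - 109 / 8 * sqrt 2)) by nra.
  assert (H1 : 0 <= 241 / 8 * sqrt 2 - 159 / 4 <= 3) by lra.
  assert (H2 : 0 <= cotb * (9 / 2 - 3 / 4 * sqrt 2) <= 6) by nra.
  assert (H3 : 0 <= / 4 * sqrt 2 <= 1) by lra.
  assert (HC2 : 0 <= C * C <= 1) by nra.
  assert (HC3 : -1 <= C * C * C <= 1) by nra.
  pose proof (product_bound _ _ _ H1 HC).
  pose proof (product_bound _ (C * C) _ H2 ltac:(lra)).
  pose proof (product_bound _ _ _ H3 HC3). lra.
Qed.

Lemma lobe_re_pos q : 0 < lobe_re q.
Proof.
  unfold lobe_re. pose proof (COS_bound q) as HC. set (C := cos q) in *.
  pose proof sqrt2_bounds as Hr. pose proof cotb_bounds as Hk. nra.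
Qed.

Lemma lobe_norm_bound q : lobe_re q * lobe_re q + lobe_im q * lobe_im q <= 28.
Proof.
  set (C := cos q).
  assert (E : lobe_re q * lobe_re q + lobe_im q * lobe_im q =
    (3103509 / 156800 - 360417 / 78400 * sqrt 2)
    + cotb * (27 / 4 * sqrt 2 - 1217 / 560) * C
    + (1317 / 560 * sqrt 2 - 1229 / 560) * (C * C)
    + cotb * (27 / 280 * sqrt 2 - 17 / 280) * (C * C * C)
    + / 140 * (C * C * (C * C))).
  { pose proof (sin_sqr q) as Es. pose proof sqrt2_sqr as Er.
    destruct scaled_cotb as (k & E & Ek).
    unfold lobe_re, lobe_im, C. rewrite E. field [Es Er Ek]. }
  rewrite E. pose proof (COS_bound q) as HC. fold C in HC.
  pose proof sqrt2_bounds as Hr. pose proof cotb_bounds as Hk.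
  assert (H1 : 0 <= cotb * (27 / 4 * sqrt 2 - 1217 / 560) <= 125 / 10) by nra.
  assert (H2 : 0 <= 1317 / 560 * sqrt 2 - 1229 / 560 <= 6 / 5) by lra.
  assert (H3 : 0 <= cotb * (27 / 280 * sqrt 2 - 17 / 280) <= 1 / 4) by nra.
  assert (HC2 : 0 <= C * C <= 1) by nra.
  assert (HC3 : -1 <= C * C * C <= 1) by nra.
  assert (0 <= C * C * (C * C) <= 1) by nra.
  pose proof (product_bound _ _ _ H1 HC).
  pose proof (product_bound _ (C * C) _ H2 ltac:(lra)).
  pose proof (product_bound _ _ _ H3 HC3). lra.
Qed.

(** Up to the factor |v|^2 the right-hand side is the derivative of the polar angle
    after the twist.  It is the sum of |v|^2 (1 + (arg v)'), which is negative at
    the corners C = 1, and of |v|^2 depth', which is positive there. *)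
Lemma winding_pos q :
  1 <= (1 + depth' q) * (lobe_re q * lobe_re q + lobe_im q * lobe_im q)
       + 3 * (lobe_re q * lobe_im' q - lobe_im q * lobe_re' q).
Proof.
  set (C := cos q).
  assert (E : (1 + depth' q) * (lobe_re q * lobe_re q + lobe_im q * lobe_im q)
       + 3 * (lobe_re q * lobe_im' q - lobe_im q * lobe_re' q) =
    (6216377 / 627200 - 1493501 / 313600 * sqrt 2)
    + cotb * (195241 / 12544 * sqrt 2 - 10100281 / 470400) * C
    + ((4290141 / 156800 * sqrt 2 - 28171511 / 940800)
       + cotb * (4451 / 1680 - 67 / 112 * sqrt 2) * C
       + (117 / 140 * sqrt 2 - 611 / 672) * (C * C)
       + cotb * (11 / 560 * sqrt 2 - / 80) * (C * C * C)
       + / 840 * (C * C * (C * C))) * (C * C)).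
  { pose proof (sin_sqr q) as Es. pose proof sqrt2_sqr as Er.
    destruct scaled_cotb as (k & E & Ek).
    unfold lobe_re, lobe_im, lobe_re', lobe_im', depth', C. rewrite E. field [Es Er Ek]. }
  rewrite E. pose proof (COS_bound q) as HC. fold C in HC.
  pose proof sqrt2_bounds as Hr. pose proof cotb_bounds as Hk.
  assert (H1 : 0 <= cotb * (195241 / 12544 * sqrt 2 - 10100281 / 470400) <= 1)
    by nra.
  assert (H3 : 0 <= cotb * (4451 / 1680 - 67 / 112 * sqrt 2) <= 4) by nra.
  assert (H5 : 0 <= cotb * (11 / 560 * sqrt 2 - / 80) <= 1) by nra.
  assert (HC2 : 0 <= C * C <= 1) by nra.
  assert (HC3 : -1 <= C * C * C <= 1) by nra.
  assert (0 <= (117 / 140 * sqrt 2 - 611 / 672) * (C * C))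
    by (apply Rmult_le_pos; lra).
  assert (0 <= C * C * (C * C)) by nra.
  pose proof (product_bound _ _ _ H1 HC).
  pose proof (product_bound _ _ _ H3 HC).
  pose proof (product_bound _ _ _ H5 HC3).
  match goal with |- 1 <= _ + ?c * (C * C) =>
    assert (0 <= c * (C * C)) by (apply Rmult_le_pos; lra) end.
  lra.
Qed.

(** * Closed curves that wind once around an axis *)

(** The curve with cylindrical coordinates (x, rho, theta) has a strictly increasing
    polar angle and closes up after one turn. *)
Record winds_once (x rho theta : R -> R) : Prop := {
  winds_speed : exists (theta' : R -> R) (m : R),
    0 < m /\ (forall t, is_derive theta t (theta' t)) /\ (forall t, m <= theta' t);
  winds_turn : forall t, theta (t + 2 * PI) = theta t + 2 * PI;
  winds_x_cont : forall t, continuous x t;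
  winds_rho_cont : forall t, continuous rho t;
  winds_x_per : periodic (2 * PI) x;
  winds_rho_per : periodic (2 * PI) rho;
  winds_rho_pos : forall t, 0 < rho t }.

Lemma winding_injective (x rho theta : R -> R) (t u : R) :
  winds_once x rho theta ->
  0 <= t < 2 * PI -> 0 <= u < 2 * PI ->
  rho t * cos (theta t) = rho u * cos (theta u) ->
  rho t * sin (theta t) = rho u * sin (theta u) -> t = u.
Proof.
  intros [(theta' & m & m_pos & D & Hm) theta_turn _ _ _ _ rho_pos] Ht Hu Ec Es.
  assert (Er : rho t = rho u).
  { rewrite <- (polar_radius_polar (rho t) (theta t)) by (left; apply rho_pos).
    rewrite Ec, Es. apply polar_radius_polar. left; apply rho_pos. }
  pose proof (rho_pos u) as Pu. rewrite Er in Ec, Es.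
  apply Rmult_eq_reg_l in Ec; [|lra]. apply Rmult_eq_reg_l in Es; [|lra].
  destruct (same_direction _ _ Ec Es) as (k & Ek).
  assert (Hth : theta (u + 2 * PI * IZR k) = theta u + 2 * PI * IZR k).
  { assert (Hp : periodic (2 * PI) (fun v => theta v - v))
      by (intros v; rewrite theta_turn; ring).
    pose proof (periodic_Z _ _ k u Hp) as E. simpl in E. lra. }
  assert (E : t = u + 2 * PI * IZR k).
  { destruct (inverse_of_derive_bound theta theta' m m_pos D Hm) as (g & L & _).
    now rewrite <- (L t), Ek, <- Hth, L. }
  pose proof PI_RGT_0.
  assert (Hk : (-1 < k < 1)%Z) by (split; apply lt_IZR; nra).
  assert (k = 0)%Z as -> by lia. lra.
Qed.

(** With tau the inverse of theta, x o tau and rho o tau are periodic functions of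
    the direction.  Subtracting the conical extension of (x/rho) o tau from the
    height makes the curve planar, and dilating by 1/(rho o tau) makes it the unit
    circle. *)
Lemma winding_isotopy (x rho theta : R -> R) :
  winds_once x rho theta ->
  (forall a, exists t, theta t = a) /\
  exists H, ambient_isotopy H /\
    forall t, H 1 (x t, rho t * cos (theta t), rho t * sin (theta t)) =
              (0, cos (theta t), sin (theta t)).
Proof.
  intros [(theta' & m & m_pos & D' & Hm) theta_turn x_cont rho_cont x_per rho_per
    rho_pos].
  destruct (inverse_of_derive_bound theta theta' m m_pos D' Hm)
    as (tau & L & L' & D).
  split; [intros a; now exists (tau a)|].
  assert (tau_turn : forall a, tau (a + 2 * PI) = tau a + 2 * PI).
  { intros a. rewrite <- (L' a) at 1. now rewrite <- theta_turn, L. }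
  assert (tau_cont : forall a, continuous tau a).
  { intros a. apply (ex_derive_continuous tau). eexists; apply D. }
  assert (rho_cont' : forall a, continuous (fun a => rho (tau a)) a)
    by (intros a; now apply (continuous_comp_R tau rho)).
  set (f := fun a => x (tau a) / rho (tau a)).
  set (g := fun a => / rho (tau a)).
  assert (f_per : periodic (2 * PI) f)
    by (intros a; unfold f; now rewrite tau_turn, x_per, rho_per).
  assert (g_per : periodic (2 * PI) g)
    by (intros a; unfold g; now rewrite tau_turn, rho_per).
  assert (f_cont : forall a, continuous f a).
  { intros a. apply (continuous_Rdiv (fun a => x (tau a)) (fun a => rho (tau a))).
    - now apply (continuous_comp_R tau x).
    - apply rho_cont'.
    - apply Rgt_not_eq, rho_pos. }
  assert (g_cont : forall a, continuous g a).
  { intros a. apply (continuous_comp_R (fun a => rho (tau a)) Rinv).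
    - apply rho_cont'.
    - apply continuous_Rinv, Rgt_not_eq, rho_pos. }
  exists (fun s p => dilate g s (shear f s p)). split.
  - apply ambient_isotopy_comp; [now apply shear_isotopy|].
    apply dilate_isotopy; [exact g_per|exact g_cont|].
    intros a. apply Rinv_0_lt_compat, rho_pos.
  - intros t. pose proof (rho_pos t) as P.
    assert (E : shear f 1 (x t, rho t * cos (theta t), rho t * sin (theta t)) =
                (0, rho t * cos (theta t), rho t * sin (theta t))).
    { unfold shear. apply vec_ext; vec_unfold; try reflexivity.
      rewrite conical_polar by (try exact f_per; lra).
      unfold f. rewrite L. field. lra. }
    rewrite E, dilate_polar by (try exact g_per; lra).
    unfold g. rewrite L. apply vec_ext; vec_unfold; field; lra.
Qed.
(** * The polar angle after the twist *)

(** The polar angle of exp(i (t + depth/3)) i v; as v has positive real part, arctan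
    gives its argument. *)
Definition angle (t : R) : R :=
  t + PI / 2 + depth (3 * t) / 3 + atan (lobe_im (3 * t) / lobe_re (3 * t)).
Definition radius (q : R) : R := sqrt (lobe_re q * lobe_re q + lobe_im q * lobe_im q).
Definition angle' (t : R) : R :=
  1 + depth' (3 * t) + 3 * (lobe_re (3 * t) * lobe_im' (3 * t)
     - lobe_im (3 * t) * lobe_re' (3 * t)) / (lobe_re (3 * t) * lobe_re (3 * t) + lobe_im (3 * t) * lobe_im (3 * t)).

Lemma is_derive_angle t : is_derive angle t (angle' t).
Proof.
  pose proof (lobe_re_pos (3 * t)) as P.
  eapply is_derive_eq.
  - apply is_derive_Rplus.
    + apply is_derive_Rplus with (g := fun t => depth (3 * t) / 3).
      * apply is_derive_Rplus; [apply @is_derive_id|apply @is_derive_const].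
      * apply is_derive_Rmult; [apply is_derive_depth|apply @is_derive_const].
    + apply (is_derive_comp atan (fun t => lobe_im (3 * t) / lobe_re (3 * t))).
      * apply is_derive_atan.
      * apply is_derive_div; [apply is_derive_lobe_im|apply is_derive_lobe_re|lra].
  - unfold angle', one, zero, scal, Rsqr; simpl; unfold mult; simpl.
    field. split; [nra|lra].
Qed.

Lemma angle'_bound t : / 28 <= angle' t.
Proof.
  pose proof (lobe_re_pos (3 * t)) as P. pose proof (lobe_norm_bound (3 * t)) as B.
  pose proof (winding_pos (3 * t)) as W. unfold angle'.
  set (n := lobe_re (3 * t) * lobe_re (3 * t) + lobe_im (3 * t) * lobe_im (3 * t)) in *.
  assert (Pn : 0 < n) by (unfold n; nra).
  apply Rle_trans with (/ n).
  - apply Rinv_le_contravar; lra.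
  - apply Rmult_le_reg_r with n; [exact Pn|]. rewrite Rinv_l by lra.
    eapply Rle_trans; [exact W|]. right. field. lra.
Qed.

Lemma triple_angle_turn t :
  cos (3 * (t + 2 * PI)) = cos (3 * t) /\ sin (3 * (t + 2 * PI)) = sin (3 * t).
Proof.
  replace (3 * (t + 2 * PI)) with (3 * t + 2 * PI * 3) by ring.
  split; apply (periodic_Z _ _ 3); [exact periodic_cos|exact periodic_sin].
Qed.

Lemma coordinates_turn t :
  depth (3 * (t + 2 * PI)) = depth (3 * t) /\ lobe_re (3 * (t + 2 * PI)) = lobe_re (3 * t) /\
  lobe_im (3 * (t + 2 * PI)) = lobe_im (3 * t).
Proof.
  destruct (triple_angle_turn t) as [Ec Es]. unfold depth, lobe_re, lobe_im. rewrite Ec, Es. tauto.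
Qed.

Lemma angle_turn t : angle (t + 2 * PI) = angle t + 2 * PI.
Proof.
  destruct (coordinates_turn t) as (EY & E1 & E2). unfold angle. rewrite EY, E1, E2. ring.
Qed.

(** The factor -1/3 turns the height -depth into the rotation angle depth/3, the
    twist that makes the polar angle monotone. *)
Lemma twist_model t :
  twist (- / 3) 1 (model t) =
  (- depth (3 * t), radius (3 * t) * cos (angle t), radius (3 * t) * sin (angle t)).
Proof.
  destruct (polar_atan _ (lobe_im (3 * t)) (lobe_re_pos (3 * t))) as [Ec Es].
  fold (radius (3 * t)) in Ec, Es.
  unfold angle. set (ph := atan (lobe_im (3 * t) / lobe_re (3 * t))) in *.
  set (r := radius (3 * t)) in *.
  set (Y := depth (3 * t)).
  replace (t + PI / 2 + Y / 3 + ph) with (PI / 2 + (t + Y / 3 + ph)) by ring.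
  rewrite <- sin_shift with (x := PI / 2 + (t + Y / 3 + ph)).
  rewrite <- cos_shift with (x := PI / 2 + (t + Y / 3 + ph)).
  replace (PI / 2 - (PI / 2 + (t + Y / 3 + ph))) with (- (t + Y / 3 + ph)) by ring.
  rewrite sin_neg, cos_neg, (sin_plus _ ph), (cos_plus _ ph), !sin_plus, !cos_plus.
  unfold twist, model, rotate. rewrite <- Ec, <- Es. fold Y.
  apply vec_ext; vec_unfold; try reflexivity;
    replace (1 * - / 3 * - Y) with (Y / 3) by field; ring.
Qed.

(** * Smoothness of trigonometric polynomials *)

(** A class of functions closed under differentiation, so all of its members are
    smooth. *)
Inductive trig_poly : (R -> R) -> Prop :=
| trig_const c : trig_poly (fun _ => c)
| trig_cos k : trig_poly (fun t => cos (k * t))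
| trig_sin k : trig_poly (fun t => sin (k * t))
| trig_ext f g : (forall t, f t = g t) -> trig_poly f -> trig_poly g
| trig_plus f g : trig_poly f -> trig_poly g -> trig_poly (fun t => f t + g t)
| trig_mult f g : trig_poly f -> trig_poly g -> trig_poly (fun t => f t * g t).

Lemma trig_derive f : trig_poly f -> exists f', trig_poly f' /\ forall t, is_derive f t (f' t).
Proof.
  induction 1 as [c|k|k|f g E Hf (f' & Tf & Df)|f g Hf (f' & Tf & Df) Hg (g' & Tg & Dg)
                  |f g Hf (f' & Tf & Df) Hg (g' & Tg & Dg)].
  - exists (fun _ => 0). split; [constructor|]. intros t. apply @is_derive_const.
  - exists (fun t => - k * sin (k * t)). split; [repeat constructor|].
    intros t. auto_derive; [exact I|ring].
  - exists (fun t => k * cos (k * t)). split; [repeat constructor|].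
    intros t. auto_derive; [exact I|ring].
  - exists f'. split; [exact Tf|]. intros t. now apply (is_derive_ext f).
  - exists (fun t => f' t + g' t). split; [now constructor|].
    intros t. now apply is_derive_Rplus.
  - exists (fun t => f' t * g t + f t * g' t). split; [now repeat constructor|].
    intros t. now apply is_derive_Rmult.
Qed.

Lemma trig_derive_n n f : trig_poly f ->
  exists h, trig_poly h /\ forall t, is_derive_n f n t (h t).
Proof.
  induction n as [|n IH]; intros Hf.
  - exists f. split; [exact Hf|]. now intros t.
  - destruct (IH Hf) as (h & Th & Dh).
    destruct (trig_derive h Th) as (h' & Th' & Dh').
    exists h'. split; [exact Th'|]. intros t. simpl.
    apply is_derive_ext with (f := h); [|apply Dh'].
    intros u. symmetry. apply is_derive_n_unique, Dh.
Qed.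

Lemma trig_smooth f n t : trig_poly f -> ex_derive_n f n t.
Proof.
  intros Hf. destruct (trig_derive_n n f Hf) as (h & _ & Dh).
  specialize (Dh t). destruct n as [|n]; [exact I|]. now exists (h t).
Qed.

Lemma trig_opp f : trig_poly f -> trig_poly (fun t => - f t).
Proof.
  intros Hf. apply trig_ext with (f := fun t => -1 * f t); [intros t; ring|].
  now repeat constructor.
Qed.

Lemma trig_cos1 : trig_poly cos.
Proof.
  apply trig_ext with (f := fun t => cos (1 * t)); [|constructor].
  intros t. now rewrite Rmult_1_l.
Qed.

Lemma trig_sin1 : trig_poly sin.
Proof.
  apply trig_ext with (f := fun t => sin (1 * t)); [|constructor].
  intros t. now rewrite Rmult_1_l.
Qed.

Ltac trig_tac :=
  lazymatch goal with
  | |- trig_poly (fun _ => ?c) => apply trig_const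
  | |- trig_poly (fun t => @?f t + @?g t) => apply (trig_plus f g); trig_tac
  | |- trig_poly (fun t => @?f t - @?g t) =>
      apply (trig_plus f (fun t => - g t)); trig_tac
  | |- trig_poly (fun t => - @?f t) => apply (trig_opp f); trig_tac
  | |- trig_poly (fun t => @?f t * @?g t) => apply (trig_mult f g); trig_tac
  | |- trig_poly (fun t => @?f t / ?c) => apply (trig_mult f (fun _ => / c)); trig_tac
  | |- trig_poly (fun t => @?f t ^ 2) =>
      apply (trig_mult f (fun t => f t * 1)); trig_tac
  | |- trig_poly (fun t => cos t) => exact trig_cos1
  | |- trig_poly (fun t => sin t) => exact trig_sin1
  | |- trig_poly (fun t => cos (?k * t)) => apply trig_cos
  | |- trig_poly (fun t => sin (?k * t)) => apply trig_sin
  | |- _ => idtac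
  end.

Lemma trig_model :
  trig_poly (fun t => vx (model t)) /\ trig_poly (fun t => vy (model t)) /\
  trig_poly (fun t => vz (model t)).
Proof.
  split; [|split]; unfold model, rotate, vx, vy, vz, depth, lobe_re, lobe_im;
    cbn [fst snd]; trig_tac.
Qed.

(** * The curve gamma *)

(** The similarity that carries the model curve to gamma; the translation puts the
    starting point at the origin. *)
Definition place (p : vec3) : vec3 :=
  frame (scal (sinb * sinb) (plus p (scal (-1) (model 0)))).

Definition unplace (q : vec3) : vec3 :=
  plus (scal (/ (sinb * sinb)) (coframe q)) (model 0).

Lemma unplace_place p : unplace (place p) = p.
Proof.
  unfold place, unplace. rewrite coframe_frame. pose proof sinb_pos.
  apply vec_ext; vec_unfold; field; lra.
Qed.

Lemma place_unplace q : place (unplace q) = q.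
Proof.
  unfold place, unplace. rewrite <- (frame_coframe q) at 2. f_equal.
  pose proof sinb_pos. apply vec_ext; vec_unfold; field; lra.
Qed.

Lemma continuous_place p : continuous place p.
Proof.
  apply (continuous_frame (fun p : vec3 => scal (sinb * sinb) (plus p (scal (-1) (model 0))))).
  destruct (continuous_id_coords p) as (Hx & Hy & Hz).
  apply (continuous_triple
    (fun p : vec3 => sinb * sinb * (vx p + -1 * vx (model 0)))
    (fun p : vec3 => sinb * sinb * (vy p + -1 * vy (model 0)))
    (fun p : vec3 => sinb * sinb * (vz p + -1 * vz (model 0)))); continuous_tac.
Qed.

Lemma continuous_unplace q : continuous unplace q.
Proof.
  assert (C : continuous coframe q)
    by (apply (continuous_coframe (fun q : vec3 => q)), continuous_id).
  destruct (continuous_coords coframe q C) as (Hx & Hy & Hz).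
  apply (continuous_triple
    (fun q : vec3 => / (sinb * sinb) * vx (coframe q) + vx (model 0))
    (fun q : vec3 => / (sinb * sinb) * vy (coframe q) + vy (model 0))
    (fun q : vec3 => / (sinb * sinb) * vz (coframe q) + vz (model 0))); continuous_tac.
Qed.

(** The second derivative only serves to make f' continuous. *)
Lemma vRInt_vderive (f f' f'' : R -> vec3) (a b : R) :
  (forall t, is_vderive f t (f' t)) -> (forall t, is_vderive f' t (f'' t)) ->
  vRInt f' a b = plus (f b) (scal (-1) (f a)).
Proof.
  intros D D'.
  assert (H : forall g g' g'' : R -> R,
    (forall t, is_derive g t (g' t)) -> (forall t, is_derive g' t (g'' t)) ->
    RInt g' a b = g b + -1 * g a).
  { intros g g' g'' Dg Dg'. apply is_RInt_unique.
    replace (g b + -1 * g a) with (minus (g b) (g a))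
      by (unfold minus, plus, opp; simpl; ring).
    apply (is_RInt_derive g g'); intros t _; [apply Dg|].
    apply @ex_derive_continuous. eexists. apply Dg'. }
  apply vec_ext; unfold vRInt; vec_unfold.
  - apply (H (fun t => vx (f t)) _ (fun t => vx (f'' t))); intros t; [apply D|apply D'].
  - apply (H (fun t => vy (f t)) _ (fun t => vy (f'' t))); intros t; [apply D|apply D'].
  - apply (H (fun t => vz (f t)) _ (fun t => vz (f'' t))); intros t; [apply D|apply D'].
Qed.

Definition sphere_curve (t : R) : vec3 := frame (rotate t (profile (3 * t))).
Definition sphere_vel (t : R) : vec3 := frame (rotate t (profile_vel (3 * t))).
Definition sphere_acc (t : R) : vec3 := frame (rotate t (profile_acc (3 * t))).

Lemma is_vderive_sphere_curve t : is_vderive sphere_curve t (sphere_vel t).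
Proof. apply is_vderive_frame, is_vderive_profile. Qed.

Lemma is_vderive_sphere_vel t : is_vderive sphere_vel t (sphere_acc t).
Proof. apply is_vderive_frame, is_vderive_profile_vel. Qed.

Lemma is_vderive_place t :
  is_vderive (fun t => place (model t)) t (cross (sphere_curve t) (sphere_vel t)).
Proof.
  apply is_vderive_ext with
    (f := fun t => frame (plus (scal (sinb * sinb) (model t))
                            (scal (- (sinb * sinb)) (model 0)))).
  { intros u. unfold place. f_equal. vec_ring. }
  unfold sphere_curve, sphere_vel. rewrite cross_frame. apply is_vderive_frame.
  destruct (is_vderive_model t) as (Hx & Hy & Hz).
  assert (H : forall (g : R -> R) l c, is_derive g t l ->
            is_derive (fun u => g u + c) t l).
  { intros g l c Hg. eapply is_derive_eq.
    - apply is_derive_Rplus; [exact Hg|apply @is_derive_const].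
    - apply Rplus_0_r. }
  split; [|split]; now apply H.
Qed.

Lemma gamma_place (t : R) :
  let B := epicycle 1 (-3) (PI / 4) (/ 2 * acos ((67 - 24 * sqrt 2) / 71)) in
  vRInt (fun u => cross (B u) (vDerive B u)) 0 t = place (model t).
Proof.
  intros B.
  assert (EB : forall u, sphere_curve u = B u) by (intros u; symmetry; apply epicycle_profile).
  assert (ED : forall u, cross (sphere_curve u) (sphere_vel u) = cross (B u) (vDerive B u)).
  { intros u. rewrite EB, (vDerive_unique B u (sphere_vel u)); [reflexivity|].
    apply is_vderive_ext with (1 := EB), is_vderive_sphere_curve. }
  transitivity (vRInt (fun u => cross (sphere_curve u) (sphere_vel u)) 0 t).
  { apply vec_ext; unfold vRInt; vec_unfold; apply RInt_ext; intros u _;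
      now rewrite ED. }
  rewrite (vRInt_vderive (fun t => place (model t)) _
    (fun t => plus (cross (sphere_vel t) (sphere_vel t)) (cross (sphere_curve t) (sphere_acc t)))).
  - replace (place (model 0)) with ((0, 0, 0) : vec3).
    + vec_ring.
    + unfold place, frame. vec_ring.
  - apply is_vderive_place.
  - intros u. apply is_vderive_cross; [apply is_vderive_sphere_curve|apply is_vderive_sphere_vel].
Qed.

Lemma model_turn t : model (t + 2 * PI) = model t.
Proof.
  destruct (coordinates_turn t) as (EY & E1 & E2). unfold model, rotate.
  now rewrite EY, E1, E2, periodic_cos, periodic_sin.
Qed.

Lemma sphere_curve_facts t :
  dot (sphere_curve t) (sphere_curve t) = 1 /\ sinb / 2 <= vnorm (sphere_vel t) /\
  dot (cross (sphere_curve t) (sphere_vel t)) (sphere_acc t) < 0.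
Proof.
  unfold sphere_curve, sphere_vel, sphere_acc.
  rewrite cross_frame, !dot_frame, cross_rotate, !dot_rotate.
  split; [apply profile_unit|]. split; [|apply profile_det].
  unfold vnorm. rewrite dot_frame, dot_rotate. pose proof sinb_pos as P.
  rewrite <- (sqrt_square (sinb / 2)) by lra.
  apply sqrt_le_1_alt. pose proof (profile_speed (3 * t)). lra.
Qed.

Lemma gamma_regular : regular_curve (fun t => place (model t)).
Proof.
  split.
  - destruct trig_model as (Tx & Ty & Tz).
    assert (H : forall a b c : R, trig_poly (fun t =>
      sinb * sinb * (vx (model t) + -1 * vx (model 0)) * a
      + (sinb * sinb * (vy (model t) + -1 * vy (model 0)) * b
         + sinb * sinb * (vz (model t) + -1 * vz (model 0)) * c)))
      by (intros; trig_tac; assumption).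
    intros n t. split; [|split]; apply trig_smooth; apply H.
  - intros t. rewrite (vDerive_unique _ _ _ (is_vderive_place t)). intros E.
    destruct (sphere_curve_facts t) as (_ & _ & Hd). rewrite E in Hd.
    revert Hd. vec_unfold. lra.
Qed.

Lemma gamma_winding :
  winds_once (fun t => - depth (3 * t)) (fun t => radius (3 * t)) angle.
Proof.
  split.
  - exists angle', (/ 28). split; [lra|].
    split; [exact is_derive_angle|exact angle'_bound].
  - exact angle_turn.
  - intros t. apply (continuous_Ropp (fun t => depth (3 * t))).
    apply @ex_derive_continuous. eexists. apply is_derive_depth.
  - intros t. apply (continuous_polar_radius (fun t => lobe_re (3 * t)) (fun t => lobe_im (3 * t)));
      apply @ex_derive_continuous; eexists; [apply is_derive_lobe_re|apply is_derive_lobe_im].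
  - intros t. destruct (coordinates_turn t) as (E & _ & _). now rewrite E.
  - intros t. destruct (coordinates_turn t) as (_ & E1 & E2). unfold radius. now rewrite E1, E2.
  - intros t. apply (polar_radius_pos (lobe_re (3 * t)) (lobe_im (3 * t))).
    left. apply Rgt_not_eq, lobe_re_pos.
Qed.

Lemma gamma_closed : closed_curve (2 * PI) (fun t => place (model t)).
Proof. intros t. now rewrite model_turn. Qed.

(** The twist makes the model wind once around the axis, so two equal points of
    gamma have equal parameters, and the isotopy to the unit circle transported by
    [place] gives a circle of radius sin beta ^2. *)
Lemma gamma_unknotted : unknotted (2 * PI) (fun t => place (model t)).
Proof.
  split; [split|].
  - apply gamma_closed.
  - intros t u Ht Hu E.
    assert (E' : twist (- / 3) 1 (model t) = twist (- / 3) 1 (model u)).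
    { rewrite <- (unplace_place (model t)), E, unplace_place. reflexivity. }
    rewrite !twist_model in E'.
    apply (winding_injective _ _ _ t u gamma_winding Ht Hu).
    + exact (f_equal vy E').
    + exact (f_equal vz E').
  - destruct (winding_isotopy _ _ _ gamma_winding) as (S & H & IH & EH).
    pose proof (ambient_isotopy_comp _ _ (twist_isotopy (- / 3)) IH) as I1.
    pose proof (ambient_isotopy_conj _ place unplace I1 continuous_place
                  continuous_unplace unplace_place place_unplace) as I2.
    eexists. split; [|exact (isotopic_image _ _ I2)].
    exists (place (0, 0, 0)), (frame (0, 1, 0)), (frame (0, 0, 1)), (sinb * sinb).
    rewrite !dot_frame. pose proof sinb_pos as P.
    split; [nra|]. do 3 (split; [vec_unfold; ring|]).
    assert (EC : forall a, place (0, cos a, sin a) =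
      plus (place (0, 0, 0))
        (plus (scal (sinb * sinb * cos a) (frame (0, 1, 0)))
           (scal (sinb * sinb * sin a) (frame (0, 0, 1))))).
    { intros a. unfold place, frame. vec_ring. }
    intros p. split.
    + intros (q & (t & ->) & ->). exists (angle t).
      rewrite unplace_place, twist_model, EH. apply EC.
    + intros (a & ->). destruct (S a) as (t & <-). exists (place (model t)).
      split; [now exists t|]. rewrite unplace_place, twist_model, EH. symmetry. apply EC.
Qed.

Theorem mainTheorem1 :
  let alpha := PI / 4 in
  let beta := / 2 * acos ((67 - 24 * sqrt 2) / 71) in
  let B := epicycle 1 (-3) alpha beta in
  let gamma := fun t : R => vRInt (fun u => cross (B u) (vDerive B u)) 0 t in
  regular_curve gamma /\
  closed_curve (2 * PI) gamma /\
  unknotted (2 * PI) gamma /\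
  exists kappa : R -> R,
    curvature_torsion gamma kappa (fun _ => 1) /\
    forall s, 0 < kappa s.
Proof.
  intros alpha beta B gamma.
  assert (E : gamma = fun t => place (model t)).
  { apply functional_extensionality. exact gamma_place. }
  rewrite E. split; [exact gamma_regular|]. split; [exact gamma_closed|].
  split; [exact gamma_unknotted|].
  apply (spherical_torsion_one _ sphere_curve sphere_vel sphere_acc (sinb / 2)).
  - pose proof sinb_pos. lra.
  - exact is_vderive_sphere_curve.
  - exact is_vderive_sphere_vel.
  - exact is_vderive_place.
  - intros t. apply sphere_curve_facts.
  - intros t. apply sphere_curve_facts.
  - intros t. apply sphere_curve_facts.
Qed.
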